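(* Let $H$ be a complex Hilbert space and let $A,B\in\mathcal{B}(H)$ be strictly positive. Then $$\int_0^1\frac{A!_tB-A}{t}\,dt=A^{1/2}\log\big(A^{-1/2}BA^{-1/2}\big)A^{1/2}.$$ That is, the relative operator entropy defined for accretive operators coincides with the usual one when the operators are strictly positive.
   Context: $\mathcal{B}(H)$ is the algebra of bounded linear operators on $H$. A self-adjoint $A\in\mathcal{B}(H)$ is positive if $\langle Ax,x\rangle\ge 0$ for all $x\in H$, and strictly positive if it is positive and invertible. $A\in\mathcal{B}(H)$ is accretive if $\Re A=(A+A^* )/2$ is strictly positive. For accretive $A,B$ and $t\in(0,1)$, the $t$-weighted harmonic mean is $A!_tB:=\big((1-t)A^{-1}+tB^{-1}\big)^{-1}$, and the relative operator entropy of $A$ and $B$ is $\mathcal{S}(A|B):=\int_0^1\frac{A!_tB-A}{t}\,dt$ (integral in operator norm). For strictly positive $A,B$ the usual relative operator entropy is $A^{1/2}\log(A^{-1/2}BA^{-1/2})A^{1/2}$, with powers and logarithm taken in the continuous functional calculus. *)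

(* Defs.v *)
From HB Require Import structures.
From mathcomp Require Import all_boot all_order all_algebra sesquilinear.
From mathcomp Require Import complex.
From mathcomp Require Import all_classical all_reals all_analysis.

Set Implicit Arguments.
Unset Strict Implicit.
Unset Printing Implicit Defensive.

Import Order.TTheory GRing.Theory Num.Theory.
Import numFieldNormedType.Exports.

Local Open Scope classical_set_scope.
Local Open Scope ring_scope.
Local Open Scope complex_scope.

(* The inner product is linear in its first argument. *)
HB.mixin Record CompleteNormedModule_isHilbert (R : realType) H
    & CompleteNormedModule R[i] H := {
  inner : {dot H for Num.conj} ;
  sqr_norm_inner : forall x : H, `|x| ^+ 2 = inner x x
}.

#[short(type="hilbertType")]
HB.structure Definition Hilbert (R : realType) :=
  {H of CompleteNormedModule R[i] H & CompleteNormedModule_isHilbert R H}.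

Section BoundedOperators.
Variables (R : realType) (V : normedModType R[i]).

Definition bounded_linear : {pred V -> V} := fun f =>
  `[< linear f /\ exists M : R[i], forall x, `|f x| <= M * `|x| >].

Record bop := BOp { bop_fun :> V -> V ; bopP : bop_fun \in bounded_linear }.

HB.instance Definition _ := [isSub for bop_fun].
HB.instance Definition _ := [Choice of bop by <:].

Lemma bounded_linear_submod_closed : GRing.submod_closed bounded_linear.
Proof.
split.
  apply/asboolP; split=> [a x y|]; first by rewrite scaler0 addr0.
  by exists 0 => x; rewrite mul0r normr0.
move=> a f g /asboolP[lf [M Mf]] /asboolP[lg [N Ng]]; apply/asboolP; split.
  move=> b x y; rewrite -[LHS]/(a *: f (b *: x + y) + g (b *: x + y)).
  rewrite -[RHS]/(b *: (a *: f x + g x) + (a *: f y + g y)).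
  by rewrite lf lg !scalerDr !scalerA addrACA (mulrC a b).
exists (`|a| * M + N) => x; rewrite -[X in `|X|]/(a *: f x + g x).
rewrite (le_trans (ler_normD _ _))// mulrDl lerD// normrZ -mulrA.
exact: ler_wpM2l.
Qed.

HB.instance Definition _ := GRing.isSubmodClosed.Build R[i] (V -> V)
  bounded_linear bounded_linear_submod_closed.
HB.instance Definition _ := [SubChoice_isSubLmodule of bop by <:].

Lemma bopext (A B : bop) : A =1 B -> A = B.
Proof. by move=> AB; apply: val_inj; apply/funext. Qed.

Lemma bop_linear (A : bop) : linear A.
Proof. by case: A => f /= /asboolP[]. Qed.

Lemma bop_bounded (A : bop) : exists M : R[i], forall x, `|A x| <= M * `|x|.
Proof. by case: A => f /= /asboolP[]. Qed.

HB.instance Definition _ (A : bop) :=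
  GRing.isLinear.Build R[i] V V _ A (@bop_linear A).

Lemma bopDE (A B : bop) x : (A + B) x = A x + B x. Proof. by []. Qed.
Lemma bopZE a (A : bop) x : (a *: A) x = a *: A x. Proof. by []. Qed.

Lemma bop_one_subproof : (idfun : V -> V) \in bounded_linear.
Proof.
apply/asboolP; split; first by [].
by exists 1 => x; rewrite mul1r.
Qed.

Lemma bop_mul_subproof (A B : bop) : (A \o B) \in bounded_linear.
Proof.
apply/asboolP; split=> [a x y|]; first by rewrite /= !linearP.
have [M AM] := bop_bounded A; have [N BN] := bop_bounded B.
exists (`|M| * `|N|) => x; rewrite (le_trans (AM _))//.
rewrite (le_trans (real_ler_norm _))//.
  apply: ger0_real; apply: le_trans (AM (B x)) => //.
rewrite normrM normr_id -mulrA ler_wpM2l// (le_trans (BN _))//.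
rewrite (le_trans (real_ler_norm _)) ?normrM ?normr_id//.
by apply: ger0_real; apply: le_trans (BN x).
Qed.

Definition bop_one : bop := BOp bop_one_subproof.
Definition bop_mul (A B : bop) : bop := BOp (bop_mul_subproof A B).

Lemma bop_mulA : associative bop_mul. Proof. by move=> *; exact: bopext. Qed.
Lemma bop_mul1 : left_id bop_one bop_mul.
Proof. by move=> *; exact: bopext. Qed.
Lemma bop_mulr1 : right_id bop_one bop_mul.
Proof. by move=> *; exact: bopext. Qed.
Lemma bop_mulDl : left_distributive bop_mul +%R.
Proof. by move=> *; exact: bopext. Qed.
Lemma bop_mulDr : right_distributive bop_mul +%R.
Proof. by move=> A B C; apply: bopext => x; exact: linearD. Qed.

(* Only a pzRingType: 1 = 0 when V is the zero space, which is allowed. *)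
HB.instance Definition _ := GRing.Zmodule_isPzRing.Build bop
  bop_mulA bop_mul1 bop_mulr1 bop_mulDl bop_mulDr.

Lemma bop_scalerAl (a : R[i]) (A B : bop) : a *: (A * B) = a *: A * B.
Proof. exact: bopext. Qed.
Lemma bop_scalerAr (a : R[i]) (A B : bop) : a *: (A * B) = A * (a *: B).
Proof. by apply: bopext => x; apply/esym; exact: linearZ. Qed.

(* Norms on V have values in R[i], so the supremum is taken over real parts. *)
Definition opnorm (A : bop) : R :=
  sup [set complex.Re `|A x| | x in [set x : V | `|x| <= 1]].

Lemma ReKnorm (x : V) : (complex.Re `|x|)%:C = `|x|.
Proof. by rewrite RRe_real// ger0_real. Qed.

Lemma opnorm_has_sup (A : bop) :
  has_sup [set complex.Re `|A x| | x in [set x : V | `|x| <= 1]].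
Proof.
split; first by exists (complex.Re `|A 0|), 0 => //=; rewrite normr0 ler01.
have [M AM] := bop_bounded A; exists (complex.Re `|M|) => _ [x x1 <-].
rewrite -lecR ReKnorm.
have -> : (complex.Re `|M|)%:C = `|M| by rewrite RRe_real// ger0_real.
rewrite (le_trans (AM x))// (le_trans (real_ler_norm _))//.
  by apply: ger0_real; exact: le_trans (AM x).
by rewrite normrM normr_id ler_piMr.
Qed.

Lemma opnorm_ub (A : bop) x : `|x| <= 1 -> `|A x| <= (opnorm A)%:C.
Proof.
move=> x1; rewrite -ReKnorm lecR; apply: ub_le_sup.
  by case: (opnorm_has_sup A).
by exists x.
Qed.

Lemma opnorm_ge0 (A : bop) : 0 <= opnorm A.
Proof.
rewrite -lecR; apply: le_trans (opnorm_ub A (x := 0) _) => //.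
by rewrite normr0.
Qed.

Lemma opnorm_le (A : bop) (M : R) :
  (forall x, `|x| <= 1 -> `|A x| <= M%:C) -> opnorm A <= M.
Proof.
move=> AM; apply: ge_sup; first by case: (opnorm_has_sup A).
by move=> _ [x x1 <-]; rewrite -lecR ReKnorm AM.
Qed.

Lemma opnormP (A : bop) x : `|A x| <= (opnorm A)%:C * `|x|.
Proof.
have [->|x0] := eqVneq x 0; first by rewrite linear0 !normr0 mulr0.
have nx : 0 < `|x| by rewrite normr_gt0.
have := @opnorm_ub A (`|x|^-1 *: x).
rewrite normrZ normfV normr_id mulVf ?gt_eqF// => /(_ (lexx _)).
by rewrite linearZ normrZ normfV normr_id ler_pdivrMl// mulrC.
Qed.

Let opnormC (A : bop) : R[i] := (opnorm A)%:C.

Let opnormD (A B : bop) : opnormC (A + B) <= opnormC A + opnormC B.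
Proof.
rewrite /opnormC -rmorphD lecR; apply: opnorm_le => x x1.
by rewrite rmorphD bopDE (le_trans (ler_normD _ _))// lerD// opnorm_ub.
Qed.

Let opnormZ_le (l : R[i]) (A : bop) : opnormC (l *: A) <= `|l| * opnormC A.
Proof.
have lE : (complex.Re `|l|)%:C = `|l| by rewrite RRe_real// ger0_real.
rewrite /opnormC -lE -(rmorphM (real_complex R)) lecR.
apply: opnorm_le => x x1; rewrite bopZE normrZ (rmorphM (real_complex R)) /= lE.
by rewrite ler_wpM2l// opnorm_ub.
Qed.

Let opnormZ (l : R[i]) (A : bop) : opnormC (l *: A) = `|l| * opnormC A.
Proof.
have [->|l0] := eqVneq l 0.
  rewrite scale0r normr0 mul0r; suff o0 : opnorm 0 = 0 by rewrite /opnormC o0.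
  apply/eqP; rewrite eq_le opnorm_ge0 andbT; apply: opnorm_le => x _.
  by rewrite -[X in `|X|]/(0 : V) normr0.
apply/eqP; rewrite eq_le opnormZ_le /= -ler_pdivlMl ?normr_gt0// -normfV.
by rewrite -[X in opnormC X](scalerK l0) opnormZ_le.
Qed.

Let opnorm0_eq0 (A : bop) : opnormC A = 0 -> A = 0.
Proof.
move=> A0; apply: bopext => x; apply/eqP; rewrite -normr_le0.
by rewrite (le_trans (opnormP A x))// -/(opnormC A) A0 mul0r.
Qed.

HB.instance Definition _ := Lmodule_isNormed.Build R[i] bop
  opnormD opnormZ opnorm0_eq0.

End BoundedOperators.

Notation "''B(' H )" := (bop H) (format "''B(' H )") : type_scope.

Section Inverse.
Variable T : pzRingType.

Definition is_inverse (a b : T) : Prop := a * b = 1 /\ b * a = 1.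

Definition invertible (a : T) : Prop := exists b, is_inverse a b.

(* The inverse of a if a is invertible, 0 otherwise. *)
Definition pinv (a : T) : T := xget 0 [set b | is_inverse a b].

End Inverse.

Section Operators.
Variables (R : realType) (H : hilbertType R).
Implicit Types (A B T X : 'B(H)) (f : R -> R) (p : {poly R}).

Definition is_adjoint A B : Prop :=
  forall x y : H, inner (A x) y = inner x (B y).

Definition selfadjoint A : Prop := is_adjoint A A.

(* In R[i], 0 <= z means that z is real and nonnegative. *)
Definition positive_op A : Prop :=
  selfadjoint A /\ forall x : H, 0 <= inner (A x) x.

Definition strictly_positive A : Prop := positive_op A /\ invertible A.

Definition spectrum T : set R[i] :=
  [set z | ~ invertible (T - z *: (1 : 'B(H)))].

Definition poly_op p T : 'B(H) := \sum_(k < size p) (p`_k)%:C *: T ^+ k.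

(* Continuous functional calculus for a self-adjoint T (whose spectrum is real):
   f(T) is the norm limit of p_n(T), for real polynomials p_n that converge to
   f uniformly on the spectrum of T. *)
Definition is_cfc T f X : Prop := exists p : nat -> {poly R},
  {uniform [set x : R | spectrum T x%:C],
    (fun n x => (p n).[x]) @ \oo --> f} /\
  poly_op (p n) T @[n --> \oo] --> X.

Definition cfc T f : 'B(H) := xget 0 (is_cfc T f).

End Operators.

Section RiemannIntegral.
Variables (R : realType) (V : normedModType R[i]).
Implicit Types (F : R -> V) (a b : R) (s t : seq R).

(* For a partition a = x_0 < x_1 < ... < x_n = b, s lists x_1, ..., x_n and t
   lists the tags, t_i being in [x_i, x_(i+1)]. *)
Definition tagged_partition a b s t : Prop :=
  [/\ itv_partition a b s, size t = size s &
      forall i, (i < size s)%N -> nth 0 (a :: s) i <= nth 0 t i <= nth 0 s i].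

Definition mesh_lt a s (d : R) : Prop :=
  forall i, (i < size s)%N -> nth 0 s i - nth 0 (a :: s) i < d.

Definition riemann_sum F a s t : V :=
  \sum_(i < size s) (nth 0 s i - nth 0 (a :: s) i)%:C *: F (nth 0 t i).

(* Convergence is in the norm of V, hence in operator norm when V is 'B(H). *)
Definition is_riemann_int F a b (v : V) : Prop :=
  forall e : R, 0 < e -> exists2 d : R, 0 < d &
    forall s t, tagged_partition a b s t -> mesh_lt a s d ->
      `|riemann_sum F a s t - v| < e%:C.

Definition riemann_integrable F a b : Prop := exists v, is_riemann_int F a b v.

Definition riemann_int F a b : V := xget 0 (is_riemann_int F a b).

End RiemannIntegral.

Section RelativeEntropy.
Variables (R : realType) (H : hilbertType R).
Implicit Types (A B : 'B(H)) (t : R).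

Definition harmonic_mean t A B : 'B(H) :=
  pinv ((1 - t)%:C *: pinv A + t%:C *: pinv B).

(* The formula is meant for t in ]0, 1[: at t = 0, where t^-1 = 0, it evaluates
   to 0, a value that does not affect the Riemann integral over [0, 1]. *)
Definition entropy_integrand A B : R -> 'B(H) :=
  fun t => (t^-1)%:C *: (harmonic_mean t A B - A).

Definition rel_entropy A B : 'B(H) := riemann_int (entropy_integrand A B) 0 1.

Definition op_pow A (r : R) : 'B(H) := cfc A (fun x => x `^ r).

Definition usual_rel_entropy A B : 'B(H) :=
  op_pow A 2^-1 * cfc (op_pow A (- 2^-1) * B * op_pow A (- 2^-1)) (@ln R)
    * op_pow A 2^-1.

End RelativeEntropy.

(* Main.v *)
Require Import Defs.
From mathcomp Require Import all_boot all_order all_algebra sesquilinear.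
From mathcomp Require Import complex ring lra.
From mathcomp Require Import all_classical all_reals all_analysis.

(** Write P and Q for the square root of A and its inverse, and T = Q B Q.
    Since A = P P and B = P T P, for 0 < t <= 1 the weighted harmonic mean of
    A and B is P h_t(T) P with h_t(x) = x / ((1 - t) x + t), so the integrand
    is P k_t(T) P with
      k_t(x) = (h_t(x) - 1) / t = (x - 1) / ((1 - t) x + t)
    ([entropy_integrandE]). For a number x > 0 the integral of k_t(x) over
    0 <= t <= 1 is ln x, and its Riemann sums converge uniformly for x in a
    compact part of the positive half-line. The norm of f(T) is at most the
    supremum of |f| over the spectrum of T, so this scalar convergence is a
    convergence of operators: the Riemann sums of k_t(T) tend to ln(T) in norm
    ([log_riemann_int]). Multiplying by P on both sides gives the theorem; the
    value at t = 0, where the integrand is 0 by convention, is harmless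
    ([eq_is_riemann_int]).

    Scalar estimate. The inequality ln(1 + y) <= y bounds the increment of
    t |-> - ln((1 - t) x + t) over [u, v] by (v - u) k_u(x) and (v - u) k_v(x).
    As k_t(x) is nondecreasing in t, a Riemann sum of mesh d is within
    d (k_1(x) - k_0(x)) = d (x - 1)^2 / x of ln x ([log_riemann_sum]).

    Functional calculus. The relation [has_cfc T f X] says that X is f(T): some
    real polynomial is at once close to f on the spectrum and, evaluated at T,
    close to X. It is compatible with sums and products, and it determines X,
    because a polynomial p with |p| <= c on the spectrum of T satisfies
    |p(T)| <= c ([opnorm_poly_op_le]). That bound says that c^2 - p(T)^2 is
    positive, hence follows from two facts: the greatest lower bound of a
    self-adjoint operator lies in its spectrum
    ([selfadjoint_spectrum_bottom]), and the real spectrum of q(T) consists of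
    values of q on the real spectrum of T ([spectral_mapping]). Existence of
    f(T) for continuous f comes from the Weierstrass theorem and the
    completeness of the space of operators.

    All inequalities are between real numbers: [rdot] and [rnorm] turn H into
    a real inner product space. *)

Set Implicit Arguments.
Unset Strict Implicit.
Unset Printing Implicit Defensive.

Import Order.TTheory GRing.Theory Num.Theory.
Import numFieldNormedType.Exports.

(** * The underlying real inner product space *)

Section RealInner.
Local Open Scope ring_scope.
Local Open Scope complex_scope.
Variables (R : realType) (H : hilbertType R).
Implicit Types u v w : H.

Lemma ReD (x y : R[i]) : complex.Re (x + y) = complex.Re x + complex.Re y.
Proof. by case: x; case: y. Qed.

Lemma ReN (x : R[i]) : complex.Re (- x) = - complex.Re x.
Proof. by case: x. Qed.

Lemma ReZ (a : R) (x : R[i]) : complex.Re (a%:C * x) = a * complex.Re x.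
Proof. by case: x => x y /=; rewrite mul0r subr0. Qed.

Definition rdot u v : R := complex.Re (inner u v).
Definition rnorm u : R := complex.Re `|u|.

Lemma rnormE u : `|u| = (rnorm u)%:C.
Proof. by rewrite /rnorm [RHS]ReKnorm. Qed.

Lemma rnorm_ge0 u : 0 <= rnorm u.
Proof. by rewrite -ler0c -rnormE. Qed.

Lemma innerC u v : inner u v = (inner v u)^*.
Proof. by rewrite hermC expr0 mul1r. Qed.

Lemma rdotC u v : rdot u v = rdot v u.
Proof. by rewrite /rdot innerC; case: (inner v u). Qed.

Lemma rdotDl u v w : rdot (u + v) w = rdot u w + rdot v w.
Proof. by rewrite /rdot linearDl ReD. Qed.

Lemma rdotZl (a : R) u v : rdot (a%:C *: u) v = a * rdot u v.
Proof. by rewrite /rdot linearZl_LR ReZ. Qed.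

Lemma rdotNl u v : rdot (- u) v = - rdot u v.
Proof. by rewrite /rdot linearNl ReN. Qed.

Lemma rdotDr u v w : rdot u (v + w) = rdot u v + rdot u w.
Proof. by rewrite !(rdotC u) rdotDl. Qed.

Lemma rdotZr (a : R) u v : rdot u (a%:C *: v) = a * rdot u v.
Proof. by rewrite !(rdotC u) rdotZl. Qed.

Lemma rdotNr u v : rdot u (- v) = - rdot u v.
Proof. by rewrite !(rdotC u) rdotNl. Qed.

(** Multiplication by i turns imaginary parts into real parts, so that the real
    form [rdot] still determines the complex inner product. *)
Lemma rdot_iZl u v : rdot ('i%C *: u) v = - complex.Im (inner u v).
Proof.
rewrite /rdot linearZl_LR /=; move: (inner u v) => [x y] /=.
by rewrite mul0r mul1r sub0r.
Qed.

Lemma rdotxx u : rdot u u = rnorm u ^+ 2.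
Proof.
rewrite /rdot -sqr_norm_inner rnormE -(rmorphXn (real_complex R)).
by [].
Qed.

Lemma rnorm_sqrB (c : R) u v :
  rnorm (u - c%:C *: v) ^+ 2 =
  rnorm u ^+ 2 - 2 * c * rdot u v + c ^+ 2 * rnorm v ^+ 2.
Proof.
rewrite -!rdotxx !(rdotDl, rdotDr, rdotNl, rdotNr, rdotZl, rdotZr) (rdotC v u).
ring.
Qed.

Lemma rnorm_gt0 u : (0 < rnorm u) = (u != 0).
Proof. by rewrite -normr_gt0 rnormE ltcR. Qed.

(** Cauchy-Schwarz inequality, from the expansion of the square of the norm of
    u - c v with c the quotient of the norms. *)
Lemma rdot_le u v : rdot u v <= rnorm u * rnorm v.
Proof.
have [->|v0] := eqVneq v 0.
  rewrite -(scale0r (0 : H)) -[0 : R[i]]/(0%:C) rdotZr mul0r.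
  by rewrite mulr_ge0 ?rnorm_ge0.
have nv : 0 < rnorm v by rewrite rnorm_gt0.
have nu := rnorm_ge0 u.
have [u0|u0] := eqVneq u 0.
  rewrite u0 -(scale0r (0 : H)) -[0 : R[i]]/(0%:C) rdotZl mul0r.
  by rewrite mulr_ge0 ?rnorm_ge0.
have {}nu : 0 < rnorm u by rewrite rnorm_gt0.
pose c := rnorm u / rnorm v.
have c0 : 0 < c by rewrite divr_gt0.
have uE : rnorm u = c * rnorm v by rewrite divfK ?gt_eqF.
have := sqr_ge0 (rnorm (u - c%:C *: v)).
rewrite rnorm_sqrB uE => h.
have : 0 <= c * (2 * (c * rnorm v ^+ 2 - rdot u v)) by lra.
by rewrite !pmulr_rge0// subr_ge0 expr2 mulrA.
Qed.

Lemma normr_rdot_le u v : `|rdot u v| <= rnorm u * rnorm v.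
Proof.
rewrite ler_norml rdot_le andbT lerNl -rdotNl (le_trans (rdot_le _ _))//.
by rewrite /rnorm normrN.
Qed.

End RealInner.

(** * The operator norm *)

Section OperatorNorm.
Local Open Scope ring_scope.
Local Open Scope complex_scope.
Local Open Scope classical_set_scope.
Variables (R : realType) (H : hilbertType R).
Implicit Types (A B C X Y : 'B(H)) (x y : H).

Lemma rnorm_opE A x : rnorm (A x) <= opnorm A * rnorm x.
Proof.
by have := opnormP A x; rewrite !rnormE -(rmorphM (real_complex R)) lecR.
Qed.

Lemma opnorm_le_rnorm A (M : R) :
  0 <= M -> (forall x, rnorm (A x) <= M * rnorm x) -> opnorm A <= M.
Proof.
move=> M0 AM; apply: opnorm_le => x; rewrite !rnormE !lecR => x1.
by rewrite (le_trans (AM x))// ler_piMr// -lecR -rnormE.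
Qed.

Lemma opnormE A : `|A| = (opnorm A)%:C.
Proof. by []. Qed.

Lemma opnormD A B : opnorm (A + B) <= opnorm A + opnorm B.
Proof. by rewrite -lecR rmorphD -!opnormE ler_normD. Qed.

Lemma opnorm0 : opnorm (0 : 'B(H)) = 0.
Proof. by apply: complexI; rewrite -opnormE normr0. Qed.

Lemma opnormN A : opnorm (- A) = opnorm A.
Proof. by apply: complexI; rewrite -!opnormE normrN. Qed.

Lemma opnorm_distC A B : opnorm (A - B) = opnorm (B - A).
Proof. by rewrite -opnormN opprB. Qed.

Lemma opnormB A B C : opnorm (A - C) <= opnorm (A - B) + opnorm (B - C).
Proof. by rewrite (le_trans _ (opnormD _ _))// addrA subrK. Qed.

Lemma opnormM A B : opnorm (A * B) <= opnorm A * opnorm B.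
Proof.
apply: opnorm_le_rnorm => [|x]; first by rewrite mulr_ge0 ?opnorm_ge0.
rewrite (le_trans (rnorm_opE A (B x)))// -mulrA.
by rewrite ler_wpM2l ?opnorm_ge0 ?rnorm_opE.
Qed.

Lemma opnorm_le0 A : opnorm A <= 0 -> A = 0.
Proof.
by rewrite -lecR -opnormE normr_le0 => /eqP.
Qed.

Lemma opnorm1_le : opnorm (1 : 'B(H)) <= 1.
Proof. by apply: opnorm_le_rnorm => // x; rewrite mul1r. Qed.

Lemma opnorm_eps_eq A B : (forall e : R, 0 < e -> opnorm (A - B) <= e) -> A = B.
Proof.
move=> AB; apply/eqP; rewrite -subr_eq0; apply/eqP/opnorm_le0.
by apply/ler_addgt0Pl => e e0; rewrite addr0 AB.
Qed.

(** Norm convergence with real tolerances; the topology of 'B(H) is stated with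
    tolerances in R[i]. *)
Definition op_cvg (u : nat -> 'B(H)) X : Prop :=
  forall e : R, 0 < e -> exists N, forall n,
    (N <= n)%N -> opnorm (u n - X) <= e.

Lemma op_cvg_uniq u X Y : op_cvg u X -> op_cvg u Y -> X = Y.
Proof.
move=> uX uY; apply: opnorm_eps_eq => e e0.
have e2 : 0 < e / 2 by rewrite divr_gt0.
have [N1 N1u] := uX _ e2; have [N2 N2u] := uY _ e2.
rewrite (le_trans (opnormB _ (u (maxn N1 N2)) _))// [leRHS]splitr lerD//.
  by rewrite opnorm_distC N1u// leq_maxl.
by rewrite N2u// leq_maxr.
Qed.

Lemma op_cvgMl C u X : op_cvg u X -> op_cvg (fun n => C * u n) (C * X).
Proof.
move=> uX e e0; have C0 : 0 < opnorm C + 1 by rewrite ltr_wpDl ?opnorm_ge0.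
have [|N Nu] := uX (e / (opnorm C + 1)); first by rewrite divr_gt0.
exists N => n /Nu; rewrite -mulrBr ler_pdivlMr// => uXe.
by rewrite (le_trans (opnormM _ _))// mulrC (le_trans _ uXe)// ler_wpM2l
  ?opnorm_ge0 ?lerDl.
Qed.

Lemma op_cvgMr C u X : op_cvg u X -> op_cvg (fun n => u n * C) (X * C).
Proof.
move=> uX e e0; have C0 : 0 < opnorm C + 1 by rewrite ltr_wpDl ?opnorm_ge0.
have [|N Nu] := uX (e / (opnorm C + 1)); first by rewrite divr_gt0.
exists N => n /Nu; rewrite -mulrBl ler_pdivlMr// => uXe.
by rewrite (le_trans (opnormM _ _))// (le_trans _ uXe)// ler_wpM2l
  ?opnorm_ge0 ?lerDl.
Qed.

(** Completeness of the space of operators: a Cauchy sequence converges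
    pointwise because H is complete, and the Cauchy estimate, uniform on the
    unit ball, passes to the pointwise limit. *)
Lemma op_cauchy_cvg (u : nat -> 'B(H)) :
  (forall e : R, 0 < e -> exists N, forall m n,
     (N <= m)%N -> (N <= n)%N -> opnorm (u m - u n) <= e) ->
  exists X, op_cvg u X.
Proof.
move=> uC.
have cv x : cvg ((u n x) @[n --> \oo]).
  apply/cauchy_cvgP/cauchy_exP => e e0.
  have {e0} [r r0 ->] : exists2 r : R, 0 < r & e = r%:C.
    exists (complex.Re e); first by move: e0; rewrite ltcE => /andP[].
    by rewrite RRe_real// gtr0_real.
  have d0 : 0 < r / 2 / (rnorm x + 1).
    by rewrite !divr_gt0// ltr_wpDl ?rnorm_ge0.
  have [N Nu] := uC _ d0.
  exists (u N x); exists N => // n Nn /=.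
  rewrite -ball_normE /= rnormE ltcR.
  have -> : u N x - u n x = (u N - u n) x by [].
  rewrite (le_lt_trans (rnorm_opE _ _))//.
  rewrite (le_lt_trans (ler_wpM2r (rnorm_ge0 _) (Nu _ _ (leqnn N) Nn)))//.
  have := rnorm_ge0 x; move: (rnorm x) => z z0; rewrite mulrAC.
  by rewrite ltr_pdivrMr ?ltr_wpDl//; nra.
pose L x := lim ((u n x) @[n --> \oo]).
have LE x (r : R) N : 0 < r -> exists2 m, (N <= m)%N & rnorm (u m x - L x) <= r.
  move=> r0; have rC : (0 : R[i]) < r%:C by rewrite ltcR.
  have [M _ Mu] := cvgr_dist_lt _ _ (cv x) _ rC.
  exists (maxn N M); first exact: leq_maxl.
  have := Mu (maxn N M) (leq_maxr _ _).
  by rewrite distrC rnormE ltcR => /ltW.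
have Ldist e N : (forall m n, (N <= m)%N -> (N <= n)%N ->
    opnorm (u m - u n) <= e) ->
    forall n x, (N <= n)%N -> rnorm (u n x - L x) <= e * rnorm x.
  move=> Nu n x Nn; apply/ler_addgt0Pr => r r0.
  have [m Nm mr] := LE x r N r0.
  rewrite -lecR -rnormE -(subrKA (u m x)) (le_trans (ler_normD _ _))//.
  rewrite !rnormE -rmorphD lecR lerD//.
  rewrite -[u n x - u m x]/((u n - u m) x) (le_trans (rnorm_opE _ _))//.
  by rewrite ler_wpM2r ?rnorm_ge0 ?Nu.
have linL : linear L.
  move=> a x y; rewrite /L; apply: cvg_lim => //.
  under eq_fun do rewrite linearP.
  by apply: cvgD; [apply: cvgZl_tmp; exact: cv|exact: cv].
have [N1 N1u] := uC 1 ltr01.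
have bL : L \in @bounded_linear R H.
  apply/asboolP; split=> //; exists (opnorm (u N1) + 1)%:C => x.
  rewrite !rnormE -(rmorphM (real_complex R)) lecR mulrDl mul1r.
  rewrite -lecR -rnormE -[L x](subKr (u N1 x)) (le_trans (ler_normB _ _))//.
  rewrite !rnormE -rmorphD lecR lerD ?rnorm_opE//.
  by have := Ldist _ _ N1u N1 x (leqnn _); rewrite mul1r.
exists (BOp bL) => e e0; have [N Nu] := uC _ e0; exists N => n Nn.
apply: opnorm_le_rnorm => [|x]; first exact: ltW.
exact: Ldist Nu n x Nn.
Qed.

End OperatorNorm.

(** * Inverses in rings *)

Section Invertible.
Local Open Scope ring_scope.
Variable T : pzRingType.
Implicit Types a b c : T.

Lemma is_inverse_uniq a b c : is_inverse a b -> is_inverse a c -> b = c.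
Proof. by move=> [ab ba] [ac ca]; rewrite -[b]mulr1 -ac mulrA ba mul1r. Qed.

Lemma pinvE a b : is_inverse a b -> Defs.pinv a = b.
Proof.
move=> ab; apply: (@is_inverse_uniq a) => //.
by apply: xgetPex; exists b.
Qed.

Lemma invertibleM a b : invertible a -> invertible b -> invertible (a * b).
Proof.
move=> [a' [aa' a'a]] [b' [bb' b'b]]; exists (b' * a'); split.
  by rewrite -mulrA (mulrA b) bb' mul1r.
by rewrite -mulrA (mulrA a') a'a mul1r.
Qed.

(** The left factor of an invertible product need not be invertible in general;
    commutation makes the one-sided inverse two-sided. *)
Lemma invertible_commM a b :
  a * b = b * a -> invertible (a * b) -> invertible a.
Proof.
move=> ab [c [abc cab]]; exists (b * c); split; first by rewrite mulrA.
have ca : c * a = a * c.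
  rewrite -[LHS]mulr1 -abc -[RHS]mul1r -cab -!mulrA; congr (c * (a * _)).
  by rewrite !mulrA ab.
by rewrite -mulrA ca mulrA -ab.
Qed.

End Invertible.

(** * Coercive and positive operators *)

Section Positivity.
Local Open Scope ring_scope.
Local Open Scope complex_scope.
Local Open Scope classical_set_scope.
Variables (R : realType) (H : hilbertType R).
Implicit Types (A B S K : 'B(H)) (x y : H).

Lemma invertibleZ (c : R[i]) A : c != 0 -> invertible (c *: A) -> invertible A.
Proof.
move=> c0 [B [AB BA]]; exists (c *: B).
by split;
  [rewrite -bop_scalerAr bop_scalerAl|rewrite -bop_scalerAl bop_scalerAr].
Qed.

(** The imaginary parts are compared by applying the real identity to i x. *)
Lemma selfadjointP S :
  selfadjoint S <-> forall x y, rdot (S x) y = rdot x (S y).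
Proof.
split=> [SS x y|SS x y]; first by rewrite /rdot SS.
apply/eqP; rewrite eq_complex -/(rdot _ _) -/(rdot _ _) SS eqxx /=.
apply/eqP/oppr_inj; rewrite -!rdot_iZl -SS; congr rdot.
by rewrite linearZ.
Qed.

Lemma positive_op_rdot A x : positive_op A -> 0 <= rdot (A x) x.
Proof. by move=> [_ /(_ x)]; rewrite lecE => /andP[]. Qed.

Lemma rdot_op_le A x : rdot (A x) x <= opnorm A * rnorm x ^+ 2.
Proof.
rewrite (le_trans (rdot_le _ _))// expr2 mulrA.
by rewrite ler_wpM2r ?rnorm_ge0 ?rnorm_opE.
Qed.

Lemma opnormX_le K n : opnorm (K ^+ n) <= opnorm K ^+ n.
Proof.
elim: n => [|n IHn]; first by rewrite !expr0 opnorm1_le.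
by rewrite !exprS (le_trans (opnormM _ _))// ler_wpM2l ?opnorm_ge0.
Qed.

Lemma expr_lt1_eps (q e : R) : 0 <= q -> q < 1 -> 0 < e ->
  exists N, forall n, (N <= n)%N -> q ^+ n <= e.
Proof.
move=> q0 q1 e0; have /cvgrPdist_le/(_ _ e0) : q ^+ n @[n --> \oo] --> (0 : R).
  by apply: cvg_expr; rewrite ger0_norm.
move=> [N _ Nq]; exists N => n Nn; have := Nq n Nn.
by rewrite /= sub0r normrN ger0_norm// exprn_ge0.
Qed.

(** The inverse is the sum of the geometric series of K. *)
Lemma neumann_invertible K : opnorm K < 1 -> invertible (1 - K).
Proof.
set q := opnorm K => q1; have q0 : 0 <= q by exact: opnorm_ge0.
pose u n := \sum_(k < n) K ^+ k : 'B(H).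
have uS n : u n.+1 = u n + K ^+ n by rewrite /u big_ord_recr.
have uKl n : (1 - K) * u n = 1 - K ^+ n.
  elim: n => [|n IHn]; first by rewrite /u big_ord0 mulr0 expr0 subrr.
  by rewrite uS mulrDr IHn mulrBl mul1r -exprS addrA subrK.
have uKr n : u n * (1 - K) = 1 - K ^+ n.
  elim: n => [|n IHn]; first by rewrite /u big_ord0 mul0r expr0 subrr.
  by rewrite uS mulrDl IHn mulrBr mulr1 -exprSr addrA subrK.
have q1' : 0 < 1 - q by rewrite subr_gt0.
have ud m n : (1 - q) * opnorm (u (m + n)%N - u m) <= q ^+ m * (1 - q ^+ n).
  elim: n => [|n IHn].
    by rewrite addn0 subrr opnorm0 expr0 subrr !mulr0.
  have : opnorm (u (m + n.+1)%N - u m) <=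
      q ^+ m * q ^+ n + opnorm (u (m + n)%N - u m).
    rewrite addnS (le_trans (opnormB _ (u (m + n)%N) _))// lerD2r.
    by rewrite uS addrAC subrr add0r -exprD opnormX_le.
  by rewrite -(ler_pM2l q1') => /le_trans; apply; rewrite exprS; lra.
have [X uX] : exists X, op_cvg u X.
  apply: op_cauchy_cvg => e e0.
  have [|N Nq] := @expr_lt1_eps q (e * (1 - q)) q0 q1.
    by rewrite mulr_gt0.
  exists N => m n; wlog mn : m n / (m <= n)%N => [wl Nm Nn|Nm Nn].
    have [mn|/ltnW nm] := leqP m n; first exact: wl.
    by rewrite opnorm_distC wl.
  rewrite opnorm_distC -(subnKC mn) -(ler_pM2l q1') (le_trans (ud _ _))//.
  rewrite [leRHS]mulrC (le_trans _ (Nq m Nm))// ler_piMr ?exprn_ge0//.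
  by rewrite gerBl exprn_ge0.
have K1 : op_cvg (fun n => 1 - K ^+ n) 1.
  move=> e e0; have [N Nq] := expr_lt1_eps q0 q1 e0; exists N => n Nn.
  by rewrite addrC addKr opnormN (le_trans (opnormX_le _ _))// Nq.
exists X; split.
  by apply: op_cvg_uniq K1; rewrite -(funext uKl); exact: op_cvgMl.
by apply: op_cvg_uniq K1; rewrite -(funext uKr); exact: op_cvgMr.
Qed.

Definition coercive (d : R) S : Prop :=
  forall x, d * rnorm x ^+ 2 <= rdot (S x) x.

(** Lax-Milgram: for small w > 0 the operator 1 - w S is a strict contraction,
    so w S = 1 - (1 - w S) is invertible by the Neumann series. *)
Lemma coercive_invertible (d : R) S : 0 < d -> coercive d S -> invertible S.
Proof.
move=> d0 dS; pose M := opnorm S; have M0 : 0 <= M by exact: opnorm_ge0.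
pose D := M ^+ 2 + d ^+ 2.
have D0 : 0 < D by rewrite ltr_wpDl ?sqr_ge0 ?exprn_gt0.
(* this w minimises 1 - 2 w d + w^2 D, an upper bound for the squared norm
   of the contraction *)
pose w := d / D; have w0 : 0 < w by rewrite divr_gt0.
have wD : w * D = d by rewrite divfK ?gt_eqF.
have wd1 : w * d <= 1.
  by rewrite /w mulrAC ler_pdivrMr// mul1r -expr2 lerDr sqr_ge0.
have q0 : 0 <= 1 - w * d by rewrite subr_ge0.
have Kn : opnorm (1 - w%:C *: S) <= Num.sqrt (1 - w * d).
  apply: opnorm_le_rnorm => [|x]; first exact: sqrtr_ge0.
  rewrite -(@ler_pXn2r _ 2) ?nnegrE ?mulr_ge0 ?sqrtr_ge0 ?rnorm_ge0//.
  rewrite exprMn sqr_sqrtr// (_ : (1 - w%:C *: S) x = x - w%:C *: S x)//.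
  rewrite rnorm_sqrB.
  have := dS x; rewrite rdotC => dSx.
  have := rnorm_opE S x; rewrite -/M.
  have := rnorm_ge0 (S x); have := rnorm_ge0 x.
  move: (rnorm x) (rnorm (S x)) (rdot x (S x)) dSx => a b r ar a0 b0 bM.
  have b2 : b ^+ 2 <= M ^+ 2 * a ^+ 2.
    by rewrite -exprMn ler_pXn2r// nnegrE mulr_ge0.
  have : w * (d * a ^+ 2) <= w * r by rewrite ler_pM2l.
  have : w ^+ 2 * b ^+ 2 <= w ^+ 2 * (M ^+ 2 * a ^+ 2).
    by rewrite ler_wpM2l ?sqr_ge0.
  have : w ^+ 2 * (M ^+ 2 * a ^+ 2) <= w * d * a ^+ 2.
    rewrite mulrA ler_wpM2r ?sqr_ge0// expr2 -mulrA ler_wpM2l ?(ltW w0)//.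
    by rewrite -wD ler_wpM2l ?(ltW w0)// lerDl sqr_ge0.
  by lra.
have : opnorm (1 - w%:C *: S) < 1.
  rewrite (le_lt_trans Kn)// -[ltRHS]sqrtr1 ltr_sqrt//.
  by rewrite gtrBl mulr_gt0.
move=> /neumann_invertible; rewrite opprB addrC subrK; apply: invertibleZ.
by rewrite -[0]/(0%:C) (inj_eq (@complexI R)) gt_eqF.
Qed.

(** Positivity of A at the vector x - c A x, where c is the inverse of
    |A| + 1, replaces the Cauchy-Schwarz inequality for the form <A x, y>. *)
Lemma positive_sqr_le A x : positive_op A ->
  rnorm (A x) ^+ 2 <= (opnorm A + 1) * rdot (A x) x.
Proof.
move=> pA; have M0 := opnorm_ge0 A; have sA := (selfadjointP A).1 pA.1.
pose c := (opnorm A + 1)^-1.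
have M1 : 0 < opnorm A + 1 by rewrite ltr_wpDl.
have c0 : 0 < c by rewrite invr_gt0.
have cM : c * (opnorm A + 1) = 1 by rewrite mulVf// gt_eqF.
have := positive_op_rdot (x - c%:C *: A x) pA.
rewrite linearB linearZ /= !(rdotDl, rdotDr, rdotNl, rdotNr, rdotZl, rdotZr).
rewrite [rdot (A (A x)) x]sA rdotxx.
have := rdot_op_le A (A x).
have := sqr_ge0 (rnorm (A x)).
move: (rnorm (A x) ^+ 2) (rdot (A x) x) (rdot (A (A x)) (A x)) => a r s a0 sa h.
have : 0 <= r - c * a.
  have : c ^+ 2 * s <= c * a.
    rewrite expr2 -mulrA ler_pM2l// -[leRHS]mul1r -cM -mulrA ler_pM2l//.
    by rewrite (le_trans sa)// ler_wpM2r// lerDl.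
  by lra.
by rewrite subr_ge0 /c ler_pdivrMl.
Qed.

(** An invertible A satisfies |x| <= |A^-1| |A x|, and the square of |A x| is
    controlled by <A x, x>. *)
Lemma strictly_positive_coercive A :
  strictly_positive A -> exists2 d : R, 0 < d & coercive d A.
Proof.
move=> [pA [B [AB BA]]].
have M1 : 0 < opnorm A + 1 by rewrite ltr_wpDl ?opnorm_ge0.
have N1 : 0 < opnorm B + 1 by rewrite ltr_wpDl ?opnorm_ge0.
exists ((opnorm A + 1) * (opnorm B + 1) ^+ 2)^-1.
  by rewrite invr_gt0 mulr_gt0// exprn_gt0.
move=> x; rewrite mulrC ler_pdivrMr ?mulr_gt0 ?exprn_gt0// mulrA.
have := positive_sqr_le x pA; rewrite mulrC => pAx.
rewrite (le_trans _ (ler_wpM2r (sqr_ge0 _) pAx))// -exprMn.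
rewrite ler_pXn2r ?nnegrE ?mulr_ge0 ?rnorm_ge0 ?(ltW N1)//.
have {1}-> : x = B (A x) by rewrite -[B (A x)]/((B * A) x) BA.
by rewrite (le_trans (rnorm_opE _ _))// mulrC ler_wpM2l ?rnorm_ge0 ?lerDl.
Qed.

Lemma selfadjointB S (c : R) :
  selfadjoint S -> selfadjoint (S - c%:C *: (1 : 'B(H))).
Proof.
move=> /selfadjointP sS; apply/selfadjointP => x y.
rewrite !(_ : forall z, (S - c%:C *: (1 : 'B(H))) z = S z - c%:C *: z)//.
rewrite rdotDl rdotDr rdotNl rdotNr.
by rewrite rdotZl rdotZr sS.
Qed.

Lemma coerciveB (m d : R) S :
  coercive (m + d) S <-> coercive d (S - m%:C *: (1 : 'B(H))).
Proof.
split=> h x; have := h x;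
  rewrite (_ : (S - m%:C *: (1 : 'B(H))) x = S x - m%:C *: x)//
    rdotDl rdotNl rdotZl rdotxx; lra.
Qed.

Lemma coercive_opnormN S : coercive (- opnorm S) S.
Proof.
move=> x; have := rdot_op_le (- S) x; rewrite opnormN.
by rewrite (_ : (- S) x = - S x)// rdotNl; lra.
Qed.

Lemma coercive0_positive S : selfadjoint S -> coercive 0 S -> positive_op S.
Proof.
move=> sS S0; split=> // x; have := S0 x; rewrite mul0r /rdot lecE => ->.
have := sS x x; rewrite [in RHS]innerC.
by case: (inner (S x) x) => a b [/= ]; rewrite andbT => bN; apply/eqP; lra.
Qed.

(** The greatest lower bound m of S is in its spectrum: otherwise S - m would be
    strictly positive, hence coercive, and m could be increased. The existence
    of a nonzero vector is what bounds the lower bounds of S from above. *)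
Lemma selfadjoint_spectrum_bottom S (x0 : H) : x0 != 0 -> selfadjoint S ->
  exists2 m : R, spectrum S m%:C & coercive m S.
Proof.
move=> x00 sS; have nx0 : 0 < rnorm x0 by rewrite rnorm_gt0.
pose E := [set c : R | coercive c S].
have hE : has_sup E.
  split; first by exists (- opnorm S); exact: coercive_opnormN.
  exists (rdot (S x0) x0 / rnorm x0 ^+ 2) => c /(_ x0).
  by rewrite ler_pdivlMr// exprn_gt0.
have Em : coercive (sup E) S.
  move=> x; have [->|x_neq0] := eqVneq x 0.
    by rewrite linear0 rdotxx /rnorm normr0 expr0n mulr0.
  have nx : 0 < rnorm x ^+ 2 by rewrite exprn_gt0// rnorm_gt0.
  rewrite -ler_pdivlMr//; apply: ge_sup; first by case: hE.
  by move=> c /(_ x); rewrite ler_pdivlMr.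
exists (sup E) => //; move=> iS.
have pS : strictly_positive (S - (sup E)%:C *: (1 : 'B(H))).
  split=> //; apply: coercive0_positive; first exact: selfadjointB.
  by apply/coerciveB; rewrite addr0.
have [d d0 /coerciveB dS] := strictly_positive_coercive pS.
have : sup E + d <= sup E by apply: ub_le_sup => //; case: hE.
by rewrite gerDl leNgt d0.
Qed.

End Positivity.

(** * Polynomials of an operator *)

Section PolynomialCalculus.
Local Open Scope ring_scope.
Local Open Scope complex_scope.
Local Open Scope classical_set_scope.
Variables (R : realType) (H : hilbertType R).
Implicit Types (T : 'B(H)) (x y : H).

(** Complex coefficients are needed to split polynomials into linear factors. *)
Definition cpoly_op (p : {poly R[i]}) T : 'B(H) :=
  \sum_(k < size p) p`_k *: T ^+ k.

Lemma cpoly_op_widen n (p : {poly R[i]}) T : (size p <= n)%N ->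
  cpoly_op p T = \sum_(k < n) p`_k *: T ^+ k.
Proof.
move=> pn; rewrite /cpoly_op (big_ord_widen n (fun k => p`_k *: T ^+ k))//.
rewrite [RHS](bigID (fun k : 'I_n => (k < size p)%N))/=.
rewrite [X in _ = _ + X]big1 ?addr0//.
by move=> k; rewrite -leqNgt => pk; rewrite nth_default// scale0r.
Qed.

Lemma cpoly_opD (p q : {poly R[i]}) T :
  cpoly_op (p + q) T = cpoly_op p T + cpoly_op q T.
Proof.
have pqn : (size (p + q)%R <= maxn (size p) (size q))%N by exact: size_polyD.
rewrite (cpoly_op_widen _ pqn) (cpoly_op_widen _ (leq_maxl _ (size q))).
rewrite (cpoly_op_widen _ (leq_maxr (size p) _)) -big_split /=.
by apply: eq_bigr => k _; rewrite coefD scalerDl.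
Qed.

Lemma cpoly_opZ c (p : {poly R[i]}) T : cpoly_op (c *: p) T = c *: cpoly_op p T.
Proof.
rewrite (cpoly_op_widen _ (size_scale_leq c p)) /cpoly_op scaler_sumr.
by apply: eq_bigr => k _; rewrite coefZ scalerA.
Qed.

Lemma cpoly_opC c T : cpoly_op c%:P T = c *: (1 : 'B(H)).
Proof.
by rewrite (cpoly_op_widen _ (size_polyC_leq1 c)) big_ord1 coefC expr0.
Qed.

Lemma cpoly_opMX (p : {poly R[i]}) T : cpoly_op (p * 'X) T = cpoly_op p T * T.
Proof.
have pn : (size (p * 'X)%R <= (size p).+1)%N.
  by rewrite (leq_trans (size_polyMleq _ _))// size_polyX addn2.
rewrite (cpoly_op_widen _ pn) big_ord_recl coefMX /= scale0r add0r mulr_suml.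
by apply: eq_bigr => k _; rewrite coefMX /= exprSr bop_scalerAl.
Qed.

Lemma cpoly_opM (p q : {poly R[i]}) T :
  cpoly_op (p * q) T = cpoly_op p T * cpoly_op q T.
Proof.
elim/poly_ind: q => [|q c IHq].
  by rewrite mulr0 -[0]/(0%:P) cpoly_opC scale0r mulr0.
rewrite mulrDr mulrA !cpoly_opD !cpoly_opMX IHq mulrDr mulrA; congr (_ + _).
by rewrite mulrC mul_polyC cpoly_opZ cpoly_opC -bop_scalerAr mulr1.
Qed.

Lemma cpoly_op_XsubC z T : cpoly_op ('X - z%:P) T = T - z *: (1 : 'B(H)).
Proof.
rewrite -['X]mul1r cpoly_opD cpoly_opMX -polyCN !cpoly_opC.
by rewrite scale1r mul1r scaleNr.
Qed.

Lemma poly_opE (p : {poly R}) T :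
  poly_op p T = cpoly_op (map_poly (real_complex R) p) T.
Proof.
rewrite /poly_op /cpoly_op size_map_poly.
by apply: eq_bigr => k _; rewrite coef_map.
Qed.

Lemma poly_opD (p q : {poly R}) T :
  poly_op (p + q) T = poly_op p T + poly_op q T.
Proof. by rewrite !poly_opE rmorphD cpoly_opD. Qed.

Lemma poly_opM (p q : {poly R}) T :
  poly_op (p * q) T = poly_op p T * poly_op q T.
Proof. by rewrite !poly_opE rmorphM cpoly_opM. Qed.

Lemma poly_opC c T : poly_op c%:P T = c%:C *: (1 : 'B(H)).
Proof. by rewrite poly_opE map_polyC cpoly_opC. Qed.

Lemma poly_opX T : poly_op 'X T = T.
Proof.
by rewrite poly_opE map_polyX -['X]mul1r cpoly_opMX cpoly_opC scale1r mul1r.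
Qed.

Lemma poly_opN (p : {poly R}) T : poly_op (- p) T = - poly_op p T.
Proof.
by rewrite -mulN1r poly_opM -polyCN poly_opC rmorphN scaleN1r mulN1r.
Qed.

Lemma poly_opB (p q : {poly R}) T :
  poly_op (p - q) T = poly_op p T - poly_op q T.
Proof. by rewrite poly_opD poly_opN. Qed.

Lemma selfadjoint_poly_op (p : {poly R}) T :
  selfadjoint T -> selfadjoint (poly_op p T).
Proof.
move=> /selfadjointP sT; apply/selfadjointP.
elim/poly_ind: p => [|p c IHp] x y.
  rewrite -[0]/(0%:P) poly_opC scale0r.
  by rewrite -[(0 : 'B(H)) x]/(0 : H) -[(0 : 'B(H)) y]/(0 : H)
    -(scale0r (0 : H)) -[0 : R[i]]/(0%:C) rdotZl rdotZr !mul0r.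
have E z : poly_op (p * 'X + c%:P) T z = T (poly_op p T z) + c%:C *: z.
  by rewrite mulrC poly_opD poly_opM poly_opX poly_opC.
have E' z : poly_op (p * 'X + c%:P) T z = poly_op p T (T z) + c%:C *: z.
  by rewrite poly_opD poly_opM poly_opX poly_opC.
by rewrite E E' rdotDl rdotDr rdotZl rdotZr sT IHp.
Qed.

(** If z = a + b i with b <> 0, then (T - z)(T - a + b i) is the coercive
    operator (T - a)^2 + b^2, hence invertible, and its factors commute. *)
Lemma spectrum_real T z : selfadjoint T -> spectrum T z -> complex.Im z = 0.
Proof.
move=> /selfadjointP sT Tz; apply: contrapT => /eqP b0; apply: Tz.
case: z b0 => a b /= b0.
pose S := T - a%:C *: (1 : 'B(H)).
have sS : selfadjoint S by apply/selfadjointB/selfadjointP.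
have E : ('X - (a +i* b)%:P) * ('X - (a -i* b)%:P) =
         ('X - a%:C%:P) * ('X - a%:C%:P) + (b ^+ 2)%:C%:P :> {poly R[i]}.
  have -> : (a +i* b) = a%:C + 'i%C * b%:C by rewrite [LHS]complexE.
  have -> : (a -i* b) = a%:C - 'i%C * b%:C.
    by rewrite [LHS]complexE rmorphN mulrN.
  have -> : (b ^+ 2)%:C = - ('i%C * b%:C) ^+ 2.
    by rewrite exprMn sqr_i mulN1r opprK rmorphXn.
  by rewrite !(polyCN, polyCD, polyC_exp); ring.
have EX q : cpoly_op (('X - (a +i* b)%:P) * q) T =
    (T - (a +i* b) *: (1 : 'B(H))) * cpoly_op q T.
  by rewrite cpoly_opM cpoly_op_XsubC.
apply: (@invertible_commM _ _ (cpoly_op ('X - (a -i* b)%:P) T)).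
  by rewrite -EX mulrC cpoly_opM !cpoly_op_XsubC.
rewrite -EX E cpoly_opD cpoly_opM !cpoly_op_XsubC -/S cpoly_opC.
apply: (@coercive_invertible _ _ (b ^+ 2)); first by rewrite exprn_even_gt0.
move=> x; rewrite -[X in rdot X x]/(S (S x) + (b ^+ 2)%:C *: x).
rewrite rdotDl rdotZl rdotxx (selfadjointP S).1// rdotxx.
by rewrite lerDr sqr_ge0.
Qed.

Lemma spectrum_prod_XsubC (r : seq R[i]) T :
  ~ invertible (cpoly_op (\prod_(z <- r) ('X - z%:P)) T) ->
  exists2 z, z \in r & spectrum T z.
Proof.
elim: r => [|z r IHr].
  rewrite big_nil cpoly_opC scale1r => -[].
  by exists 1; rewrite /is_inverse mulr1.
rewrite big_cons cpoly_opM cpoly_op_XsubC => nTz.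
have [Tz|Tz] := pselect (spectrum T z); first by exists z; rewrite ?mem_head.
have [|w wr Tw] := IHr.
  by move=> ir; apply: nTz; apply: invertibleM => //; exact: contrapT.
by exists w; rewrite ?in_cons ?wr ?orbT.
Qed.

(** Factor p - m into linear factors over the complex numbers: if p(T) - m is
    not invertible, then neither is T - z for some root z, and z is real because
    T is self-adjoint. When p is the constant m, every point of the spectrum
    will do, and the spectrum is nonempty because H is nonzero. *)
Lemma spectral_mapping (x0 : H) T p (m : R) : x0 != 0 -> selfadjoint T ->
  spectrum (poly_op p T) m%:C -> exists2 l : R, spectrum T l%:C & p.[l] = m.
Proof.
move=> x00 sT; rewrite /spectrum/= => pm.
pose q := map_poly (real_complex R) (p - m%:P).
have qE : poly_op p T - m%:C *: (1 : 'B(H)) = cpoly_op q T.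
  by rewrite -poly_opE poly_opB poly_opC.
have q_root l : root q l%:C -> p.[l] = m.
  rewrite /root horner_map hornerD hornerN hornerC => /eqP.
  by rewrite -[0]/(0%:C) => /complexI/eqP; rewrite subr_eq0 => /eqP.
have [q0|q0] := eqVneq q 0.
  have [l Tl _] := selfadjoint_spectrum_bottom x00 sT.
  by exists l => //; apply: q_root; rewrite q0 root0.
have [r rE] := closed_field_poly_normal q.
have [|z zr Tz] := @spectrum_prod_XsubC r T.
  move=> [b [ib bi]]; apply: pm; rewrite qE rE cpoly_opZ.
  have lq0 : lead_coef q != 0 by rewrite lead_coef_eq0.
  exists ((lead_coef q)^-1 *: b); split.
    by rewrite -bop_scalerAr -bop_scalerAl scalerA mulVf// scale1r.
  by rewrite -bop_scalerAr -bop_scalerAl scalerA mulfV// scale1r.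
have zE : z = (complex.Re z)%:C.
  by rewrite [LHS]complexE (spectrum_real sT Tz) mulr0 addr0.
exists (complex.Re z); first by rewrite -zE.
by apply: q_root; rewrite -zE rE rootZ ?lead_coef_eq0// root_prod_XsubC.
Qed.

(** The least spectral value m of q(T), for q = c^2 - p^2, is a value of q on
    the spectrum of T, hence m >= 0; thus q(T) >= m >= 0, that is
    |p(T) x| <= c |x| for all x. *)
Lemma opnorm_poly_op_le T p (c : R) : selfadjoint T -> 0 <= c ->
  (forall l : R, spectrum T l%:C -> `|p.[l]| <= c) ->
  opnorm (poly_op p T) <= c.
Proof.
move=> sT c0 pc; apply: opnorm_le_rnorm => // x.
have [->|x0] := eqVneq x 0; first by rewrite linear0 /rnorm normr0 mulr0.
pose q := (c ^+ 2)%:P - p * p.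
have [m qm mq] := selfadjoint_spectrum_bottom x0 (selfadjoint_poly_op q sT).
have [l Tl ql] := spectral_mapping x0 sT qm.
have m0 : 0 <= m.
  rewrite -ql !hornerE -expr2 subr_ge0 -[_.[l] ^+ 2]real_normK ?num_real//.
  by rewrite ler_pXn2r ?nnegrE// pc.
have : 0 <= rdot (poly_op q T x) x.
  by rewrite (le_trans _ (mq x))// mulr_ge0 ?sqr_ge0.
rewrite /q poly_opB poly_opC poly_opM.
rewrite -[X in rdot X x]/((c ^+ 2)%:C *: x - poly_op p T (poly_op p T x)).
rewrite rdotDl rdotNl rdotZl (selfadjointP _).1; last first.
  exact: selfadjoint_poly_op.
by rewrite !rdotxx subr_ge0 -exprMn ler_pXn2r ?nnegrE ?mulr_ge0 ?rnorm_ge0.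
Qed.

End PolynomialCalculus.

(** * Weierstrass approximation *)

Section Weierstrass.
Local Open Scope ring_scope.
Local Open Scope classical_set_scope.
Variable R : realType.
Implicit Types (f : R -> R) (g h : nat -> R) (a b x y e : R).

(** The n-th Bernstein polynomial of g : its value at x is the expectation of
    g(k) when k counts the successes in n trials of probability x, and the
    recursion conditions on one of the trials. This form gives the mean value
    and variance by induction, without binomial coefficients. *)
Fixpoint bernstein n g : {poly R} :=
  if n is n'.+1 then
    (1 - 'X) * bernstein n' g + 'X * bernstein n' (g \o succn)
  else (g 0%N)%:P.

Lemma bernsteinS n g x : (bernstein n.+1 g).[x] =
  (1 - x) * (bernstein n g).[x] + x * (bernstein n (g \o succn)).[x].
Proof. by rewrite /= !hornerE. Qed.

Lemma bernstein_le n g h x : 0 <= x <= 1 ->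
  (forall k, (k <= n)%N -> g k <= h k) ->
  (bernstein n g).[x] <= (bernstein n h).[x].
Proof.
move=> /andP[x0 x1]; elim: n g h => [|n IHn] g h gh.
  by rewrite /= !hornerC gh.
rewrite !bernsteinS lerD// ler_wpM2l ?subr_ge0//; apply: IHn => k kn.
  by rewrite gh// leqW.
exact: gh.
Qed.

Lemma bernstein_linear n (c : R) g h x :
  (bernstein n (fun k => c * g k + h k)).[x] =
  c * (bernstein n g).[x] + (bernstein n h).[x].
Proof.
elim: n g h => [|n IHn] g h; first by rewrite /= !hornerC.
rewrite !bernsteinS.
have -> : (fun k => c * g k + h k) \o succn =
  (fun k => c * (g \o succn) k + (h \o succn) k) by [].
by rewrite !IHn; ring.
Qed.

Lemma bernstein_cst n (c : R) x : (bernstein n (fun=> c)).[x] = c.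
Proof.
elim: n => [|n IHn]; first by rewrite /= hornerC.
rewrite bernsteinS (_ : (fun=> c) \o succn = (fun=> c))// IHn; ring.
Qed.

(** Bias-variance decomposition of the quadratic error, for all centres c at
    once because the recursion shifts the centre. *)
Lemma bernstein_variance n (c : R) x :
  (bernstein n (fun k => (k%:R - c) ^+ 2)).[x] =
  (n%:R * x - c) ^+ 2 + n%:R * (x * (1 - x)).
Proof.
elim: n c => [|n IHn] c; first by rewrite /= hornerC; ring.
rewrite bernsteinS IHn.
have -> : (fun k : nat => (k%:R - c) ^+ 2) \o succn =
          (fun k : nat => (k%:R - (c - 1)) ^+ 2) :> (nat -> R).
  by apply/funext => k /=; rewrite -natr1; congr (_ ^+ 2); ring.
by rewrite IHn -natr1; ring.
Qed.

(** Uniform continuity bounds the increment by e when |y - x| < d ; when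
    |y - x| >= d, the oscillation of f is at most C (y - x)^2 with C the
    oscillation divided by d^2. *)
Lemma continuous_quadratic_modulus f a b e : a <= b ->
  (forall x, a <= x <= b -> {for x, continuous f}) -> 0 < e ->
  exists2 C, 0 <= C & forall x y, a <= x <= b -> a <= y <= b ->
    `|f y - f x| <= e + C * (y - x) ^+ 2.
Proof.
move=> ab fc e0.
have fw : {within `[a, b], continuous f}.
  by apply: continuous_in_subspaceT => x; rewrite inE/= in_itv/=; exact: fc.
have [M _ fM] := EVT_max ab fw; have [m _ fm] := EVT_min ab fw.
have [d d0 fd] : exists2 d, 0 < d & forall x y, a <= x <= b -> a <= y <= b ->
    `|y - x| < d -> `|f y - f x| <= e.
  have /compact_near_coveringP cpt := @segment_compact _ a b.
  pose P d x := a <= x <= b ->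
    forall y, a <= y <= b -> `|y - x| < d -> `|f y - f x| <= e.
  have nP x : `[a, b] x -> \forall x' \near x & d \near 0^'+, P d x'.
    rewrite /= in_itv/= => xab; have e2 : 0 < e / 2 by rewrite divr_gt0.
    have [r /= r0 fr] := cvgr_dist_lt _ _ (fc x xab) _ e2.
    have {}fr y : `|x - y| < r -> `|f x - f y| < e / 2 by exact: fr.
    have r2 : 0 < r / 2 by rewrite divr_gt0.
    near=> x' d => _ y _ yx'.
    have x'r : `|x - x'| < r / 2.
      by near: x'; exact: (cvgr_dist_lt id).
    have dr : d < r / 2 by near: d; exact: nbhs_right_lt.
    rewrite -(subrKA (f x)) (le_trans (ler_normD _ _))// [leRHS]splitr.
    rewrite lerD// ltW//; last first.
      by rewrite fr// (lt_trans x'r)// ltr_pdivrMr//; lra.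
    rewrite distrC fr// -(subrKA x') (le_lt_trans (ler_normD _ _))//.
    by rewrite [ltRHS]splitr ltrD// distrC (lt_trans yx').
  have [d/= d0 Pd] := cpt _ _ P _ nP.
  exists (d / 2); first by rewrite divr_gt0.
  have d2 : `|0 - d / 2| < d.
    by rewrite sub0r normrN gtr0_norm ?divr_gt0// ltr_pdivrMr//; lra.
  move=> x y xab; apply: (Pd (d / 2) d2 _ x _ xab).
    by rewrite /= divr_gt0.
  by rewrite /= in_itv.
exists ((f M - f m) / d ^+ 2) => [|x y xab yab].
  rewrite divr_ge0 ?sqr_ge0// subr_ge0; apply: (le_trans (fm a _) (fM a _));
    by rewrite in_itv/= lexx.
have [xyd|dxy] := ltP `|y - x| d.
  rewrite (le_trans (fd _ _ xab yab xyd))// lerDl mulr_ge0 ?sqr_ge0//.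
  rewrite divr_ge0 ?sqr_ge0// subr_ge0; apply: (le_trans (fm a _) (fM a _));
    by rewrite in_itv/= lexx.
have fMm : `|f y - f x| <= f M - f m.
  have := fM _ xab; have := fM _ yab; have := fm _ xab; have := fm _ yab.
  by rewrite ler_norml; lra.
have d2 : d ^+ 2 <= (y - x) ^+ 2.
  by rewrite -[leRHS]real_normK ?num_real// ler_pXn2r ?nnegrE// ltW.
rewrite (le_trans fMm)// -mulrAC ler_wpDl ?(ltW e0)// ler_pdivlMr ?exprn_gt0//.
by rewrite ler_wpM2l// (le_trans _ fMm).
Unshelve. all: by end_near. Qed.

(** Bernstein's proof. By the quadratic modulus, the error at x is at most e / 2
    plus C times the mean square distance from x to the nodes, which is of
    order 1 / n. *)
Lemma weierstrass f a b e : a < b ->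
  (forall x, a <= x <= b -> {for x, continuous f}) -> 0 < e ->
  exists p : {poly R}, forall x, a <= x <= b -> `|f x - p.[x]| <= e.
Proof.
move=> ab fc e0; have e2 : 0 < e / 2 by rewrite divr_gt0.
have [C C0 fC] := continuous_quadratic_modulus (ltW ab) fc e2.
have L0 : 0 < b - a by rewrite subr_gt0.
have [n n0 nC] : exists2 n : nat, 0 < n%:R :> R &
    C * (b - a) ^+ 2 / n%:R <= e / 2.
  pose D := C * (b - a) ^+ 2 / (e / 2).
  have D0 : 0 <= D by rewrite divr_ge0 ?(ltW e2)// mulr_ge0// sqr_ge0.
  have [n nD] : exists n : nat, D < n%:R.
    by exists (Num.bound D); exact: archi_boundP.
  have n0 := le_lt_trans D0 nD; exists n => //.
  by rewrite ler_pdivrMr// [leRHS]mulrC -ler_pdivrMr// ltW.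
pose node k := a + k%:R / n%:R * (b - a).
pose p := bernstein n (f \o node) \Po ((b - a)^-1 *: ('X - a%:P)).
exists p => x xab; rewrite horner_comp !hornerE.
set s := _ * (x - a).
have s01 : 0 <= s <= 1.
  case/andP: xab => ax xb; rewrite /s mulr_ge0 ?invr_ge0 ?subr_ge0 ?(ltW ab)//=.
  by rewrite mulrC ler_pdivrMr// mul1r lerB.
have xs : x - a = s * (b - a) by rewrite /s mulrAC mulVf ?mul1r// gt_eqF.
have nodeab k : (k <= n)%N -> a <= node k <= b.
  move=> kn; have kn01 : 0 <= (k%:R / n%:R : R) <= 1.
    by rewrite divr_ge0//= ler_pdivrMr// mul1r ler_nat.
  rewrite /node; move: (_ / _) kn01 => t /andP[t0 t1].
  by apply/andP; split; nra.
pose K := C * ((b - a) / n%:R) ^+ 2.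
have nodex k : C * (node k - x) ^+ 2 = K * (k%:R - n%:R * s) ^+ 2.
  rewrite /K -mulrA -exprMn; congr (_ * _ ^+ 2).
  rewrite (_ : node k - x = k%:R / n%:R * (b - a) - (x - a)); last first.
    by rewrite /node; ring.
  by rewrite xs; field; rewrite gt_eqF.
have dist k : (k <= n)%N ->
    `|f (node k) - f x| <= K * (k%:R - n%:R * s) ^+ 2 + e / 2.
  by move=> kn; rewrite -nodex [leRHS]addrC fC// nodeab.
have var : K * (n%:R * (s * (1 - s))) <= e / 2.
  rewrite (le_trans _ nC)//.
  rewrite (_ : K * _ = C * (b - a) ^+ 2 / n%:R * (s * (1 - s))); last first.
    by rewrite /K; field; rewrite gt_eqF.
  case/andP: s01 => s0 s1; rewrite ler_piMr//; last by nra.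
  by rewrite !mulr_ge0 ?sqr_ge0 ?invr_ge0// ltW.
have up : (bernstein n (f \o node)).[s] <= f x + e.
  have := @bernstein_le n (f \o node)
    (fun k => K * (k%:R - n%:R * s) ^+ 2 + (f x + e / 2)) s s01.
  rewrite bernstein_linear bernstein_variance bernstein_cst => /(_ _) h.
  have {}h : (bernstein n (f \o node)).[s] <=
      K * ((n%:R * s - n%:R * s) ^+ 2 + n%:R * (s * (1 - s))) + (f x + e / 2).
    by apply: h => k kn /=; have := dist k kn; rewrite ler_norml; lra.
  by move: h; rewrite subrr expr0n /=; lra.
have dn : f x - e <= (bernstein n (f \o node)).[s].
  have := @bernstein_le n
    (fun k => - K * (k%:R - n%:R * s) ^+ 2 + (f x - e / 2)) (f \o node) s s01.
  rewrite bernstein_linear bernstein_variance bernstein_cst => /(_ _) h.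
  have {}h : - K * ((n%:R * s - n%:R * s) ^+ 2 + n%:R * (s * (1 - s))) +
      (f x - e / 2) <= (bernstein n (f \o node)).[s].
    by apply: h => k kn /=; have := dist k kn; rewrite ler_norml; lra.
  by move: h; rewrite subrr expr0n /=; lra.
by rewrite ler_norml; lra.
Qed.

End Weierstrass.

(** * Continuous functional calculus *)

Section FunctionalCalculus.
Local Open Scope ring_scope.
Local Open Scope complex_scope.
Local Open Scope classical_set_scope.
Variables (R : realType) (H : hilbertType R).
Implicit Types (S T X Y : 'B(H)) (f g : R -> R).

Lemma spectrum_le_opnorm S (m : R) : spectrum S m%:C -> `|m| <= opnorm S.
Proof.
move=> Sm; rewrite leNgt; apply/negP => mS; apply: Sm.
have [m0|m0] := leP 0 m.
- rewrite ger0_norm// in mS.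
  have cS : coercive (m - opnorm S) (- S - (- m)%:C *: (1 : 'B(H))).
    apply: (coerciveB _ _ _).1; rewrite addrA addNr add0r -opnormN.
    exact: coercive_opnormN.
  have := coercive_invertible _ cS; rewrite subr_gt0 => /(_ mS).
  have -> : - S - (- m)%:C *: (1 : 'B(H)) = (-1) *: (S - m%:C *: (1 : 'B(H))).
    by rewrite rmorphN scaleNr opprK scaleN1r opprB addrC.
  apply: invertibleZ.
  by rewrite oppr_eq0 oner_eq0.
- rewrite ltr0_norm// in mS.
  apply: (@coercive_invertible _ _ (- opnorm S - m)); first by lra.
  by apply: (coerciveB _ _ _).1; rewrite addrC subrK; exact: coercive_opnormN.
Qed.

(** T - l divides p(T) - p(l), and the factors commute. *)
Lemma spectrum_poly_op T (p : {poly R}) (l : R) :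
  spectrum T l%:C -> spectrum (poly_op p T) p.[l]%:C.
Proof.
move=> Tl ip; apply: Tl.
have : root (p - p.[l]%:P) l by rewrite /root !hornerE subrr.
move=> /factor_theorem[q qE].
have XE : poly_op ('X - l%:P) T = T - l%:C *: (1 : 'B(H)).
  by rewrite poly_opB poly_opX poly_opC.
have pE : poly_op p T - p.[l]%:C *: (1 : 'B(H)) =
    (T - l%:C *: (1 : 'B(H))) * poly_op q T.
  by rewrite -(poly_opC _ T) -poly_opB qE mulrC poly_opM XE.
apply: (@invertible_commM _ _ (poly_op q T)); last by rewrite -pE.
by rewrite -XE -!poly_opM mulrC.
Qed.

(** A form of the functional calculus with a tolerance in place of a sequence of
    polynomials: it is equivalent to [is_cfc], and closed under algebraic
    operations by direct estimates. *)
Definition has_cfc T f X : Prop := forall e : R, 0 < e ->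
  exists p : {poly R}, (forall l : R, spectrum T l%:C -> `|f l - p.[l]| <= e) /\
    opnorm (X - poly_op p T) <= e.

Lemma has_cfc_poly T (p : {poly R}) : has_cfc T (horner p) (poly_op p T).
Proof.
move=> e e0; exists p; rewrite subrr opnorm0 ltW//; split=> // l _.
by rewrite subrr normr0 ltW.
Qed.

Lemma has_cfc_ext T f g X : (forall l : R, spectrum T l%:C -> f l = g l) ->
  has_cfc T f X -> has_cfc T g X.
Proof.
move=> fg fX e e0; have [p [fp pX]] := fX e e0; exists p; split=> // l Tl.
by rewrite -fg// fp.
Qed.

Lemma has_cfc_le T f X (c : R) : selfadjoint T -> has_cfc T f X -> 0 <= c ->
  (forall l : R, spectrum T l%:C -> `|f l| <= c) -> opnorm X <= c.
Proof.
move=> sT fX c0 fc; apply/ler_addgt0Pr => e e0.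
have [p [fp pX]] := fX (e / 2) (divr_gt0 e0 (ltr0n _ 2)).
have : opnorm (poly_op p T) <= c + e / 2.
  apply: opnorm_poly_op_le => //; first by rewrite addr_ge0// ltW// divr_gt0.
  move=> l Tl; rewrite -[p.[l]](subKr (f l)) (le_trans (ler_normB _ _))//.
  by rewrite lerD ?fc ?fp.
have := opnormD (X - poly_op p T) (poly_op p T).
by rewrite subrK; lra.
Qed.

(** In particular f is bounded on the spectrum, as products require. *)
Lemma has_cfc_ge T f X (l : R) :
  has_cfc T f X -> spectrum T l%:C -> `|f l| <= opnorm X.
Proof.
move=> fX Tl; apply/ler_addgt0Pr => e e0.
have [p [fp pX]] := fX (e / 2) (divr_gt0 e0 (ltr0n _ 2)).
have := spectrum_le_opnorm (spectrum_poly_op (p := p) Tl).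
have := fp l Tl; have := ler_normD (f l - p.[l]) p.[l]; rewrite subrK.
have := opnormD (poly_op p T - X) X; rewrite subrK opnorm_distC; lra.
Qed.

Lemma has_cfcD T f g X Y : has_cfc T f X -> has_cfc T g Y ->
  has_cfc T (fun x => f x + g x) (X + Y).
Proof.
move=> fX gY e e0.
have [p [fp pX]] := fX (e / 2) (divr_gt0 e0 (ltr0n _ 2)).
have [q [gq qY]] := gY (e / 2) (divr_gt0 e0 (ltr0n _ 2)).
exists (p + q); split=> [l Tl|].
  rewrite hornerD opprD addrACA [leRHS]splitr (le_trans (ler_normD _ _))//.
  by rewrite lerD ?fp ?gq.
rewrite poly_opD opprD addrACA [leRHS]splitr (le_trans (opnormD _ _))//.
by rewrite lerD.
Qed.

(** Both errors, f g - p q on the spectrum and X Y - p(T) q(T) in norm, split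
    as f (g - q) + (f - p) q, and |f| <= |X|, |g| <= |Y| on the spectrum. *)
Lemma has_cfcM T f g X Y : has_cfc T f X -> has_cfc T g Y ->
  has_cfc T (fun x => f x * g x) (X * Y).
Proof.
move=> fX gY e e0; pose K := opnorm X + opnorm Y + 1.
have X0 := opnorm_ge0 X; have Y0 := opnorm_ge0 Y.
have K1 : 1 <= K by rewrite lerDr addr_ge0.
have K0 : 0 < K by rewrite (lt_le_trans _ K1).
pose d := Num.min 1 (e / (2 * K)).
have d0 : 0 < d by rewrite lt_min ltr01 divr_gt0 ?mulr_gt0.
have d1 : d <= 1 by rewrite ge_min lexx.
have dK : d * (2 * K) <= e.
  by rewrite -ler_pdivlMr ?mulr_gt0// ge_min lexx orbT.
have [p [fp pX]] := fX d d0; have [q [gq qY]] := gY d d0.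
(* x, y, dx, dy stand for |f|, |g|, |f - p|, |g - q| on the spectrum, or for
   the norms of the corresponding operators *)
have bound (x y q' dx dy : R) : 0 <= x -> 0 <= y -> 0 <= dx -> 0 <= dy ->
    x <= opnorm X -> y <= opnorm Y -> dx <= d -> dy <= d -> q' <= y + dy ->
    x * dy + dx * q' <= e.
  move=> x0 y0 dx0 dy0 xX yY dxd dyd q'y.
  have : x * dy <= opnorm X * d by rewrite ler_pM.
  have : dx * q' <= d * (opnorm Y + 1).
    rewrite (le_trans (ler_wpM2l dx0 q'y))// ler_pM// ?addr_ge0//.
    by rewrite lerD// (le_trans dyd).
  have : d * (opnorm X + (opnorm Y + 1)) <= d * (2 * K).
    by rewrite ler_pM2l//; move: K0; rewrite /K; lra.
  by lra.
exists (p * q); split=> [l Tl|].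
  have -> : f l * g l - (p * q).[l] =
      f l * (g l - q.[l]) + (f l - p.[l]) * q.[l] by rewrite hornerM; ring.
  rewrite (le_trans (ler_normD _ _))// !normrM.
  apply: (bound _ `|g l|) => //; first exact: has_cfc_ge Tl.
  - exact: has_cfc_ge Tl.
  - exact: fp.
  - exact: gq.
  - by rewrite -[X in `|X| <= _](subKr (g l)) ler_normB.
have -> : X * Y - poly_op (p * q) T =
    X * (Y - poly_op q T) + (X - poly_op p T) * poly_op q T.
  by rewrite poly_opM mulrBr mulrBl addrA subrK.
rewrite (le_trans (opnormD _ _))//.
rewrite (le_trans (lerD (opnormM _ _) (opnormM _ _)))//.
apply: (bound _ (opnorm Y)) => //; try exact: opnorm_ge0.
by rewrite -[X in opnorm X <= _](subKr Y) (le_trans (opnormD _ _))// opnormN.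
Qed.

Lemma has_cfcB T f g X Y : has_cfc T f X -> has_cfc T g Y ->
  has_cfc T (fun x => f x - g x) (X - Y).
Proof.
move=> fX gY; have := has_cfcD fX (has_cfcM (has_cfc_poly T (- 1)%:P) gY).
rewrite poly_opC [(-1)%:C]rmorphN scaleN1r mulN1r.
by apply: has_cfc_ext => l _; rewrite hornerC mulN1r.
Qed.

Lemma has_cfcZ T f X (c : R) :
  has_cfc T f X -> has_cfc T (fun x => c * f x) (c%:C *: X).
Proof.
move=> fX; have := has_cfcM (has_cfc_poly T c%:P) fX.
rewrite poly_opC -bop_scalerAl mul1r.
by apply: has_cfc_ext => l _; rewrite hornerC.
Qed.

Lemma has_cfc_sum T n (f : 'I_n -> R -> R) (X : 'I_n -> 'B(H)) :
  (forall i, has_cfc T (f i) (X i)) ->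
  has_cfc T (fun x => \sum_(i < n) f i x) (\sum_(i < n) X i).
Proof.
elim: n f X => [|n IHn] f X fX.
  rewrite big_ord0; have := has_cfc_poly T 0.
  rewrite -[X in poly_op X _]/(0%:P) poly_opC scale0r.
  by apply: has_cfc_ext => l _; rewrite big_ord0 hornerC.
rewrite big_ord_recl.
have := has_cfcD (fX ord0) (IHn _ _ (fun i => fX (lift ord0 i))).
by apply: has_cfc_ext => l _; rewrite big_ord_recl.
Qed.

Lemma has_cfc_uniq T f X Y : selfadjoint T ->
  has_cfc T f X -> has_cfc T f Y -> X = Y.
Proof.
move=> sT fX fY; apply/eqP; rewrite -subr_eq0; apply/eqP/opnorm_le0.
apply: (has_cfc_le sT (has_cfcB fX fY)) => // l _.
by rewrite subrr normr0.
Qed.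

Lemma has_cfc_sequence T f X : has_cfc T f X ->
  exists p : nat -> {poly R},
    (forall n l, spectrum T l%:C -> `|f l - (p n).[l]| <= n.+1%:R^-1) /\
    (forall n, opnorm (X - poly_op (p n) T) <= n.+1%:R^-1).
Proof.
move=> fX; have /choice[p pP] : forall n, exists p : {poly R},
    (forall l : R, spectrum T l%:C -> `|f l - p.[l]| <= n.+1%:R^-1) /\
    opnorm (X - poly_op p T) <= n.+1%:R^-1.
  by move=> n; apply: fX; rewrite invr_gt0.
by exists p; split=> n; [case: (pP n)|case: (pP n)].
Qed.

(** A norm limit of the self-adjoint operators p(T), p real. *)
Lemma has_cfc_selfadjoint T f X :
  selfadjoint T -> has_cfc T f X -> selfadjoint X.
Proof.
move=> sT fX; apply/selfadjointP => x y.
apply/eqP; rewrite -subr_eq0 -normr_le0; apply/ler_addgt0Pl => e e0.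
rewrite addr0.
have [d d0 de] : exists2 d, 0 < d & d * (2 * rnorm x * rnorm y) <= e.
  pose N := 2 * rnorm x * rnorm y.
  have N0 : 0 <= N by rewrite !mulr_ge0 ?rnorm_ge0.
  exists (e / (N + 1)); first by rewrite divr_gt0// ltr_wpDl.
  by rewrite -/N mulrAC ler_pdivrMr ?ltr_wpDl// ler_pM2l// lerDl.
have [p [_ pX]] := fX d d0.
have sP := (selfadjointP _).1 (selfadjoint_poly_op p sT) x y.
set D := X - poly_op p T in pX.
have XE z : X z = D z + poly_op p T z.
  by rewrite -[RHS]/((D + poly_op p T) z) subrK.
rewrite !XE rdotDl rdotDr sP opprD addrACA subrr addr0.
have Dn z : rnorm (D z) <= d * rnorm z.
  by rewrite (le_trans (rnorm_opE _ _))// ler_wpM2r ?rnorm_ge0.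
have := normr_rdot_le (D x) y; have := normr_rdot_le x (D y).
have := ler_wpM2r (rnorm_ge0 y) (Dn x); have := ler_wpM2l (rnorm_ge0 x) (Dn y).
have := ler_normB (rdot (D x) y) (rdot x (D y)).
by lra.
Qed.

Lemma is_cfc_has_cfc T f X : is_cfc T f X -> has_cfc T f X.
Proof.
move=> [p [pf pX]] e e0.
have e0C : (0 : R[i]) < e%:C by rewrite ltcR.
have [N1 _ N1X] := cvgr_dist_lt _ _ pX _ e0C.
pose V := [set h : R -> R | forall l : R, spectrum T l%:C -> `|f l - h l| < e].
have [N2 _ N2f] : \forall n \near \oo, V (fun x => (p n).[x]).
  apply: pf; apply/uniform_nbhs.
  exists [set xy | ball xy.1 e xy.2]; split.
    exact: (entourage_ball _ (PosNum e0)).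
  by move=> h hE l Tl; apply: hE.
exists (p (maxn N1 N2)); split=> [l Tl|].
  by rewrite ltW//; apply: N2f Tl; exact: leq_maxr.
have := N1X _ (leq_maxl N1 N2); rewrite opnormE ltcR; exact: ltW.
Qed.

Lemma has_cfc_is_cfc T f X : has_cfc T f X -> is_cfc T f X.
Proof.
move=> /has_cfc_sequence[p [pf pX]]; exists p; split.
  move=> V /uniform_nbhs[E [entE EV]].
  move: entE; rewrite -entourage_ballE => -[e /= e0 eE].
  have [N _ Ne] := near_infty_natSinv_lt (PosNum e0).
  exists N => // n Nn /=; apply: EV => l Tl; apply: eE => /=.
  rewrite /ball /= (le_lt_trans (pf n l Tl))//.
  exact: Ne.
apply/cvgrPdist_lt => e e0.
have re0 : 0 < complex.Re e by move: e0; rewrite ltcE => /andP[].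
have eE : e = (complex.Re e)%:C by rewrite RRe_real// gtr0_real.
have [N _ Ne] := near_infty_natSinv_lt (PosNum re0).
exists N => // n Nn /=; rewrite eE opnormE ltcR (le_lt_trans (pX n))//.
exact: Ne.
Qed.

Lemma cfcE T f X : selfadjoint T -> has_cfc T f X -> cfc T f = X.
Proof.
move=> sT fX; apply: (has_cfc_uniq sT _ fX).
apply: is_cfc_has_cfc; apply: (@xgetPex _ 0 (is_cfc T f)).
by exists X; exact: has_cfc_is_cfc.
Qed.

(** The Weierstrass approximants of f are uniformly Cauchy on the spectrum, so
    their values at T are Cauchy in norm. *)
Lemma has_cfc_continuous T f (a b : R) : selfadjoint T -> a < b ->
  (forall l : R, spectrum T l%:C -> a <= l <= b) ->
  (forall x, a <= x <= b -> {for x, continuous f}) ->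
  has_cfc T f (cfc T f).
Proof.
move=> sT ab Tab fc.
have /choice[p pf] n : exists p : {poly R}, forall l : R, spectrum T l%:C ->
    `|f l - p.[l]| <= n.+1%:R^-1.
  have [|p fp] := weierstrass (e := n.+1%:R^-1) ab fc.
    by rewrite invr_gt0.
  by exists p => l /Tab; exact: fp.
have small (e : R) : 0 < e -> exists N, forall n, (N <= n)%N -> n.+1%:R^-1 <= e.
  move=> e0; have [N _ Ne] := near_infty_natSinv_lt (PosNum e0).
  by exists N => n Nn; apply: ltW; exact: Ne.
have [X pX] : exists X, op_cvg (fun n => poly_op (p n) T) X.
  apply: op_cauchy_cvg => e e0.
  have [N Ne] := small _ (divr_gt0 e0 (ltr0n _ 2)).
  exists N => m n Nm Nn; rewrite -poly_opB; apply: opnorm_poly_op_le => //.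
    exact: ltW.
  move=> l Tl; rewrite hornerD hornerN -(subrKA (f l)).
  rewrite (le_trans (ler_normD _ _))// [leRHS]splitr lerD//.
    by rewrite distrC (le_trans (pf m l Tl))// Ne.
  by rewrite (le_trans (pf n l Tl))// Ne.
suff fX : has_cfc T f X by rewrite (cfcE sT fX).
move=> e e0; have [N1 N1e] := small e e0; have [N2 N2X] := pX e e0.
exists (p (maxn N1 N2)); split=> [l Tl|].
  by rewrite (le_trans (pf _ l Tl))// N1e// leq_maxl.
by rewrite opnorm_distC N2X// leq_maxr.
Qed.

End FunctionalCalculus.

(** * Riemann sums of monotone functions *)

Section RiemannSums.
Local Open Scope ring_scope.
Local Open Scope complex_scope.
Local Open Scope classical_set_scope.
Variable R : realType.
Implicit Types (a b d : R) (s t : seq R).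

(** Partitions of arbitrarily small mesh exist; without them every vector would
    be a Riemann integral. *)
Lemma uniform_partition a b d : a < b -> 0 < d ->
  exists s, tagged_partition a b s s /\ mesh_lt a s d.
Proof.
move=> ab d0; have L0 : 0 < b - a by rewrite subr_gt0.
have [n nd] : exists n : nat, (b - a) / d < n.+1%:R.
  exists (Num.bound ((b - a) / d)); rewrite (lt_trans (archi_boundP _))//.
    by rewrite divr_ge0// ltW.
  by rewrite ltr_nat.
pose h := (b - a) / n.+1%:R.
have h0 : 0 < h by rewrite divr_gt0.
have hd : h < d by rewrite ltr_pdivrMr// mulrC -ltr_pdivrMr.
pose node k := a + k%:R * h.
have node0 : node 0%N = a by rewrite /node mul0r addr0.
have nodeS k : node k.+1 = node k + h by rewrite /node -natr1; ring.
pose s := mkseq (node \o succn) n.+1.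
have sE i : (i < n.+1)%N -> nth 0 s i = node i + h.
  by move=> ni; rewrite nth_mkseq//= nodeS.
have sE' x0 i : (i < n.+1)%N -> nth x0 (a :: s) i = node i.
  by case: i => [|i] ni; [rewrite /= node0|rewrite /= nth_mkseq// ltnW].
have ss : size s = n.+1 by rewrite size_mkseq.
exists s; split; last first.
  by move=> i; rewrite ss => ni; rewrite sE// sE'// addrAC subrr add0r.
split=> //.
  split.
    apply/(pathP 0) => i; rewrite ss => ni.
    by rewrite sE// sE'// ltrDl.
  rewrite (last_nth 0) ss /= nth_mkseq//= /node /h.
  by rewrite mulrC divfK ?pnatr_eq0// subrKC.
by move=> i; rewrite ss => ni; rewrite sE// sE'// lerDl lexx ltW.
Qed.

Lemma tagged_partition_bounds a b s t i : tagged_partition a b s t ->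
  (i < size s)%N ->
  [/\ a <= nth 0 (a :: s) i, nth 0 (a :: s) i < nth 0 s i & nth 0 s i <= b].
Proof.
move=> [abs _ _] si; split.
- by rewrite (set_nth_default b) ?(itv_partition_nth_ge _ abs)//= ltnS ltnW.
- by case: abs => /(pathP 0)/(_ i si).
- rewrite -[nth 0 s i]/(nth 0 (a :: s) i.+1) (set_nth_default b)//.
  by rewrite (itv_partition_nth_le _ abs).
Qed.

Lemma telescope_partition a b s t (F : R -> R) : tagged_partition a b s t ->
  \sum_(i < size s) (F (nth 0 s i) - F (nth 0 (a :: s) i)) = F b - F a.
Proof.
move=> [abs _ _].
rewrite -(itv_partition_nth_size 0 abs).
rewrite -(big_mkord xpredT (fun i => F (nth 0 s i) - F (nth 0 (a :: s) i))).
by rewrite (telescope_sumr (fun i => F (nth 0 (a :: s) i))).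
Qed.

(** On each subinterval, the increment of F and the corresponding term of the
    sum lie between the same two bounds, (v - u) g(u) and (v - u) g(v); the gaps
    g(v) - g(u) telescope to g(b) - g(a). *)
Lemma monotone_riemann_sum (F g : R -> R) a b d s t :
  (forall u v, a <= u -> u <= v -> v <= b -> g u <= g v) ->
  (forall u v, a <= u -> u <= v -> v <= b ->
     (v - u) * g u <= F v - F u <= (v - u) * g v) ->
  tagged_partition a b s t -> mesh_lt a s d ->
  `|\sum_(i < size s) (nth 0 s i - nth 0 (a :: s) i) * g (nth 0 t i)
    - (F b - F a)| <= d * (g b - g a).
Proof.
move=> g_nd Fg abst mesh.
rewrite -(telescope_partition F abst) -(telescope_partition g abst).
rewrite -sumrB mulr_sumr (le_trans (ler_norm_sum _ _ _))//.
apply: ler_sum => i _.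
have [ax xs sb] := tagged_partition_bounds abst (ltn_ord i).
have [_ _ /(_ i (ltn_ord i))/andP[xt ts]] := abst.
have := mesh i (ltn_ord i).
move: (nth 0 s i) (nth 0 (a :: s) i) (nth 0 t i) ax xs sb xt ts.
move=> v u w au uv vb uw wv vud.
have /andP[lo hi] := Fg u v au (ltW uv) vb.
have guw := g_nd u w au uw (le_trans wv vb).
have gwv := g_nd w v (le_trans au uw) wv vb.
have vu0 : 0 < v - u by rewrite subr_gt0.
have h1 : (v - u) * g u <= (v - u) * g w by rewrite ler_pM2l.
have h2 : (v - u) * g w <= (v - u) * g v by rewrite ler_pM2l.
rewrite (@le_trans _ _ ((v - u) * (g v - g u)))//.
  by rewrite ler_norml mulrBr; lra.
by rewrite ler_wpM2r ?subr_ge0 ?(ltW vud)// (le_trans guw).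
Qed.

End RiemannSums.

(** * Riemann integrals with values in a normed space *)

Section RiemannIntegral.
Local Open Scope ring_scope.
Local Open Scope complex_scope.
Local Open Scope classical_set_scope.
Variables (R : realType) (V : normedModType R[i]).
Implicit Types (F G : R -> V) (a b : R).

Lemma is_riemann_int_uniq F a b v w : a < b ->
  is_riemann_int F a b v -> is_riemann_int F a b w -> v = w.
Proof.
move=> ab Fv Fw; apply/eqP; rewrite -subr_eq0 -normr_eq0 -ReKnorm.
rewrite -[0]/(0%:C) (inj_eq (@complexI R)) eq_le; apply/andP; split; last first.
  by rewrite -ler0c ReKnorm.
apply/ler_addgt0Pl => e e0; rewrite addr0.
have e2 : 0 < e / 2 by rewrite divr_gt0.
have [d1 d10 Fv1] := Fv _ e2; have [d2 d20 Fw2] := Fw _ e2.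
have [|s [abs mesh]] := @uniform_partition R a b (Num.min d1 d2) ab.
  by rewrite lt_min d10.
have m1 : mesh_lt a s d1.
  by move=> i si; rewrite (lt_le_trans (mesh i si))// ge_min lexx.
have m2 : mesh_lt a s d2.
  by move=> i si; rewrite (lt_le_trans (mesh i si))// ge_min lexx orbT.
rewrite -lecR ReKnorm -(subrKA (riemann_sum F a s s)).
rewrite (le_trans (ler_normD _ _))//.
rewrite (splitr e) rmorphD lerD// ltW//; last exact: Fw2.
by rewrite distrC Fv1.
Qed.

Lemma riemann_intE F a b v : a < b -> is_riemann_int F a b v ->
  riemann_int F a b = v.
Proof.
move=> ab Fv; apply: (is_riemann_int_uniq ab _ Fv).
by apply: (@xgetPex _ 0 (is_riemann_int F a b)); exists v.
Qed.

(** Only the first tag of a partition can be the left endpoint a, so the two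
    Riemann sums differ by at most the mesh times |G a - F a|. *)
Lemma eq_is_riemann_int F G a b v : a < b ->
  (forall x, a < x -> x <= b -> F x = G x) ->
  is_riemann_int F a b v -> is_riemann_int G a b v.
Proof.
move=> ab FG Fv e e0.
have e2 : 0 < e / 2 by rewrite divr_gt0.
have [d1 d10 Fv1] := Fv _ e2.
pose c := complex.Re `|G a - F a|.
have c0 : 0 <= c by rewrite -ler0c ReKnorm.
have c1 : 0 < c + 1 by rewrite ltr_wpDl.
exists (Num.min d1 (e / 2 / (c + 1))); first by rewrite lt_min d10 divr_gt0.
move=> s t abst mesh.
have m1 : mesh_lt a s d1.
  by move=> i si; rewrite (lt_le_trans (mesh i si))// ge_min lexx.
rewrite -(subrKA (riemann_sum F a s t)) (le_lt_trans (ler_normD _ _))//.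
rewrite (splitr e) rmorphD ler_ltD//; last exact: Fv1.
rewrite /riemann_sum -sumrB.
case: s abst mesh {m1} => [|s0 s] abst mesh.
  by rewrite big_ord0 normr0 ler0c ltW.
rewrite big_ord_recl big1 ?addr0 => [|i _]; last first.
  have [_ _ /(_ _ (ltn_ord (lift ord0 i)))/andP[xt ts]] := abst.
  have [_ _ sb] := tagged_partition_bounds abst (ltn_ord (lift ord0 i)).
  have [ax xs _] :=
    tagged_partition_bounds abst (ltn_ord (widen_ord (leqnSn _) i)).
  rewrite -scalerBr FG ?subrr ?scaler0//; last exact: le_trans ts sb.
  by rewrite (lt_le_trans _ xt)// (le_lt_trans ax).
have [_ _ /(_ 0%N isT)/andP[xt ts]] := abst.
have [_ xs sb] := @tagged_partition_bounds R a b _ _ 0%N abst isT.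
rewrite -scalerBr normrZ /=.
have [->|ta] := eqVneq (nth 0 t 0%N) a; last first.
  rewrite FG ?subrr ?normr0 ?mulr0 ?ler0c ?(ltW e2)//; last first.
    exact: le_trans ts sb.
  by rewrite lt_neqAle eq_sym ta.
rewrite -[`|G a - F a|]ReKnorm -/c ger0_norm ?ler0c ?subr_ge0 ?(ltW xs)//.
rewrite -(rmorphM (real_complex R)) lecR.
have /= := mesh 0%N isT; rewrite lt_min => /andP[_] /ltW m.
rewrite (le_trans (ler_wpM2r c0 m))// mulrAC ler_pdivrMr// ler_pM2l//.
by rewrite lerDl.
Qed.

End RiemannIntegral.

(** * The logarithm as an integral *)

Section LogarithmIntegral.
Local Open Scope ring_scope.
Local Open Scope complex_scope.
Local Open Scope classical_set_scope.
Variable R : realType.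
Implicit Types (x u v d : R) (s t : seq R).

Definition wmean u x : R := (1 - u) * x + u.

(** The derivative of - ln (wmean u x) with respect to u. *)
Definition log_kernel u x : R := (x - 1) / wmean u x.

Lemma wmean_gt0 u x : 0 < x -> 0 <= u <= 1 -> 0 < wmean u x.
Proof.
move=> x0 /andP[u0 u1]; rewrite /wmean.
have [->|u_neq1] := eqVneq u 1; first by rewrite subrr mul0r add0r.
have {u_neq1}u1 : 0 < 1 - u by rewrite subr_gt0 lt_neqAle u_neq1.
by rewrite ltr_pwDl// mulr_gt0.
Qed.

Lemma log_kernel_nd x : 0 < x ->
  forall u v, 0 <= u -> u <= v -> v <= 1 -> log_kernel u x <= log_kernel v x.
Proof.
move=> x0 u v u0 uv v1; have v0 := le_trans u0 uv; have u1 := le_trans uv v1.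
have wu : 0 < wmean u x by rewrite wmean_gt0// u0.
have wv : 0 < wmean v x by rewrite wmean_gt0// v0.
rewrite /log_kernel ler_pdivrMr// mulrAC ler_pdivlMr// -subr_ge0.
rewrite (_ : _ - _ = (v - u) * (x - 1) ^+ 2); last by rewrite /wmean; ring.
by rewrite mulr_ge0 ?sqr_ge0// subr_ge0.
Qed.

(** Both bounds are ln y - ln z <= (y - z) / z, a form of ln (1 + y) <= y, at
    the values of [wmean] at u and v. *)
Lemma log_kernel_increment x : 0 < x ->
  forall u v, 0 <= u -> u <= v -> v <= 1 ->
  (v - u) * log_kernel u x <= - ln (wmean v x) - - ln (wmean u x)
    <= (v - u) * log_kernel v x.
Proof.
move=> x0 u v u0 uv v1; have v0 := le_trans u0 uv; have u1 := le_trans uv v1.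
have wu : 0 < wmean u x by rewrite wmean_gt0// u0.
have wv : 0 < wmean v x by rewrite wmean_gt0// v0.
have ln_le (y z : R) : 0 < y -> 0 < z -> ln y - ln z <= (y - z) / z.
  move=> y0 z0; rewrite -ln_div ?posrE//.
  have -> : y / z = 1 + (y - z) / z by field; rewrite gt_eqF.
  apply: le_ln1Dx; rewrite ltr_pdivlMr//; lra.
have wB : wmean u x - wmean v x = (v - u) * (x - 1) by rewrite /wmean; ring.
have := ln_le _ _ wv wu; have := ln_le _ _ wu wv.
rewrite -(opprB (wmean u x)) wB mulNr /log_kernel !mulrA.
by move=> h1 h2; apply/andP; split; lra.
Qed.

Lemma log_riemann_sum x d s t : 0 < x -> tagged_partition 0 1 s t ->
  mesh_lt 0 s d ->
  `|\sum_(i < size s) (nth 0 s i - nth 0 (0 :: s) i) * log_kernel (nth 0 t i) x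
    - ln x| <= d * ((x - 1) ^+ 2 / x).
Proof.
move=> x0 abst mesh.
have := monotone_riemann_sum (log_kernel_nd x0) (log_kernel_increment x0)
  abst mesh.
have w1 : wmean 1 x = 1 by rewrite /wmean; ring.
have w0 : wmean 0 x = x by rewrite /wmean; ring.
rewrite w1 w0 ln1 oppr0 opprK add0r /log_kernel w1 w0.
by rewrite (_ : (x - 1) / 1 - _ = (x - 1) ^+ 2 / x)//; field; rewrite gt_eqF.
Qed.

Lemma continuous_wmean u x : {for x, continuous (wmean u)}.
Proof.
apply: cvgD; last exact: cvg_cst.
by apply: cvgM; [exact: cvg_cst|exact: cvg_id].
Qed.

Lemma continuous_log_kernel u x : 0 < x -> 0 <= u <= 1 ->
  {for x, continuous (log_kernel u)}.
Proof.
move=> x0 u01; apply: cvgM.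
  by apply: cvgB; [exact: cvg_id|exact: cvg_cst].
by apply: cvgV; [rewrite gt_eqF// wmean_gt0|exact: continuous_wmean].
Qed.

Lemma continuous_powR (r x : R) :
  0 < x -> {for x, continuous (fun y : R => y `^ r)}.
Proof.
move=> x0; apply/differentiable_continuous/derivable1_diffP.
by apply: derivable_powR; rewrite in_itv/= x0.
Qed.

End LogarithmIntegral.

(** * Relative operator entropy *)

Section RelativeEntropy.
Local Open Scope ring_scope.
Local Open Scope complex_scope.
Local Open Scope classical_set_scope.
Variables (R : realType) (H : hilbertType R).
Implicit Types (A B P Q T X Y : 'B(H)) (f : R -> R) (m M u x : R).

(** The bounds must be strict, m < M, for the Weierstrass theorem to apply on
    [m, M]; this is why 1 is added to the norm of A. *)
Lemma strictly_positive_spectrum A : strictly_positive A ->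
  exists m M, [/\ 0 < m, m < M &
    forall l : R, spectrum A l%:C -> m <= l <= M].
Proof.
move=> hA; have [d d0 dA] := strictly_positive_coercive hA.
exists d, (d + (opnorm A + 1)); split=> //.
  by rewrite ltrDl ltr_wpDl ?opnorm_ge0.
move=> l Al; apply/andP; split.
  rewrite leNgt; apply/negP => ld; apply: Al.
  apply: (@coercive_invertible _ _ (d - l)); first by rewrite subr_gt0.
  by apply: (coerciveB _ _ _).1; rewrite subrKC.
have := spectrum_le_opnorm Al; rewrite ler_norml => /andP[_]; lra.
Qed.

Lemma has_cfc_positive A f : strictly_positive A ->
  (forall x, 0 < x -> {for x, continuous f}) -> has_cfc A f (cfc A f).
Proof.
move=> hA fc; have [m [M [m0 mM mMA]]] := strictly_positive_spectrum hA.
apply: (has_cfc_continuous hA.1.1 mM mMA) => x /andP[mx _].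
by apply: fc; exact: lt_le_trans mx.
Qed.

Lemma spectrum_gt0 A (l : R) : strictly_positive A -> spectrum A l%:C -> 0 < l.
Proof.
move=> hA; have [m [M [m0 _ mMA]]] := strictly_positive_spectrum hA.
by move=> /mMA /andP[ml _]; exact: lt_le_trans ml.
Qed.

Lemma has_cfc_op_pow A (r : R) : strictly_positive A ->
  has_cfc A (fun x => x `^ r) (op_pow A r).
Proof.
by move=> hA; apply: has_cfc_positive => // x; exact: continuous_powR.
Qed.

Lemma op_powD A (r q : R) : strictly_positive A ->
  op_pow A r * op_pow A q = op_pow A (r + q).
Proof.
move=> hA; apply: (has_cfc_uniq hA.1.1 _ (has_cfc_op_pow (r + q) hA)).
have := has_cfcM (has_cfc_op_pow r hA) (has_cfc_op_pow q hA).
apply: has_cfc_ext => l /(spectrum_gt0 hA) l0.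
by rewrite powRD ?(gt_eqF l0) ?implybT.
Qed.

Lemma op_pow0 A : strictly_positive A -> op_pow A 0 = 1.
Proof.
move=> hA; have := has_cfc_poly A 1%:P; rewrite poly_opC scale1r.
move=> h; apply: (has_cfc_uniq hA.1.1 (has_cfc_op_pow 0 hA)).
by apply: has_cfc_ext h => l _; rewrite hornerC powRr0.
Qed.

Lemma op_pow1 A : strictly_positive A -> op_pow A 1 = A.
Proof.
move=> hA; have := has_cfc_poly A 'X; rewrite poly_opX.
move=> h; apply: (has_cfc_uniq hA.1.1 (has_cfc_op_pow 1 hA)).
apply: has_cfc_ext h => l /(spectrum_gt0 hA) l0.
by rewrite hornerX powRr1// ltW.
Qed.

Lemma congr_strictly_positive Q B : selfadjoint Q -> invertible Q ->
  strictly_positive B -> strictly_positive (Q * B * Q).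
Proof.
move=> sQ iQ [pB iB]; have sB := (selfadjointP B).1 pB.1.
have sQ' := (selfadjointP Q).1 sQ.
split; last by do 2?apply: invertibleM.
split.
  apply/selfadjointP => x y.
  by rewrite -![(Q * B * Q) _]/(Q (B (Q _))) !(sQ', sB).
move=> x; rewrite -[(Q * B * Q) x]/(Q (B (Q x))) sQ; exact: pB.2.
Qed.

Lemma is_riemann_int_congr P Q (K : R -> 'B(H)) (a b : R) X :
  is_riemann_int K a b X ->
  is_riemann_int (fun u => P * K u * Q) a b (P * X * Q).
Proof.
move=> KX e e0; pose c := opnorm P * opnorm Q + 1.
have c0 : 0 < c by rewrite ltr_wpDl// mulr_ge0 ?opnorm_ge0.
have [|d d0 Kd] := KX (e / c); first by rewrite divr_gt0.
exists d => // s t abst mesh; have := Kd s t abst mesh.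
rewrite !opnormE !ltcR ltr_pdivlMr// => h; rewrite (le_lt_trans _ h)//.
have -> : riemann_sum (fun u => P * K u * Q) a s t - P * X * Q =
    P * (riemann_sum K a s t - X) * Q.
  rewrite mulrBr mulrBl /riemann_sum mulr_sumr mulr_suml; congr (_ - _).
  by apply: eq_bigr => i _; rewrite -bop_scalerAr -bop_scalerAl.
rewrite (le_trans (opnormM _ _))//.
rewrite (le_trans (ler_wpM2r (opnorm_ge0 _) (opnormM _ _)))//.
by rewrite mulrAC [leLHS]mulrC ler_wpM2l ?opnorm_ge0// lerDl.
Qed.

(** The difference between a Riemann sum and ln(T) is the functional calculus of
    the scalar difference, which on [m, M] is at most the mesh times
    (M + 1)^2 / m. *)
Lemma log_riemann_int T : strictly_positive T ->
  is_riemann_int (fun u => cfc T (log_kernel u)) 0 1 (cfc T (@ln R)).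
Proof.
move=> hT e e0; have [m [M [m0 mM mMT]]] := strictly_positive_spectrum hT.
have M0 := lt_trans m0 mM.
pose c := (M + 1) ^+ 2 / m.
have c0 : 0 < c by rewrite divr_gt0// exprn_gt0// addr_gt0.
exists (e / 2 / c) => [|s t abst mesh]; first by rewrite divr_gt0// divr_gt0.
rewrite opnormE ltcR (@le_lt_trans _ _ (e / 2))//; last first.
  by rewrite ltr_pdivrMr// ltr_pMr// ltr1n.
have hln : has_cfc T (@ln R) (cfc T (@ln R)).
  by apply: has_cfc_positive => // x; exact: continuous_ln.
have hsum : has_cfc T (fun x => \sum_(i < size s)
    (nth 0 s i - nth 0 (0 :: s) i) * log_kernel (nth 0 t i) x)
    (riemann_sum (fun u => cfc T (log_kernel u)) 0 s t).
  apply: has_cfc_sum => i; apply: has_cfcZ; apply: has_cfc_positive => // x x0.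
  apply: continuous_log_kernel => //.
  have [ax xs sb] := tagged_partition_bounds abst (ltn_ord i).
  have [_ _ /(_ i (ltn_ord i))/andP[xt ts]] := abst.
  by rewrite (le_trans ax xt) (le_trans ts sb).
apply: (has_cfc_le hT.1.1 (has_cfcB hsum hln)); first by rewrite ltW// divr_gt0.
move=> l Tl; have /andP[ml lM] := mMT l Tl; have l0 := lt_le_trans m0 ml.
rewrite (le_trans (log_riemann_sum l0 abst mesh))//.
rewrite mulrAC ler_pdivrMr// ler_pM2l ?divr_gt0// /c.
rewrite ler_pM ?sqr_ge0 ?invr_ge0 ?(ltW l0)//; last by rewrite lef_pV2 ?posrE.
by rewrite -[leLHS]real_normK ?num_real// ler_pXn2r ?nnegrE ?ler_norml//; lra.
Qed.

(** With w(x) = (1 - u) x + u and T' the inverse of T, the operator to invert is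
    T' w(T), while 1 + u k_u(x) = x / w(x) for k = [log_kernel]. *)
Lemma harmonic_mean_inverse T T' u : strictly_positive T -> is_inverse T T' ->
  0 <= u <= 1 ->
  is_inverse ((1 - u)%:C *: (1 : 'B(H)) + u%:C *: T')
             (1 + u%:C *: cfc T (log_kernel u)).
Proof.
move=> hT [TT' T'T] u01; set K := cfc T _.
pose U : 'B(H) := 1 + u%:C *: K; rewrite -/U.
pose w : {poly R} := (1 - u) *: 'X + u%:P.
have wE : poly_op w T = T * ((1 - u)%:C *: (1 : 'B(H)) + u%:C *: T').
  rewrite poly_opD poly_opC -mul_polyC poly_opM poly_opX poly_opC.
  by rewrite mulrDr -!bop_scalerAr TT' mulr1 -bop_scalerAl mul1r.
have wE' : poly_op w T = ((1 - u)%:C *: (1 : 'B(H)) + u%:C *: T') * T.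
  rewrite poly_opD poly_opC -mul_polyC poly_opM poly_opX poly_opC.
  by rewrite mulrDl -!bop_scalerAl T'T mul1r.
have hK : has_cfc T (log_kernel u) K.
  by apply: has_cfc_positive => // x x0; exact: continuous_log_kernel.
have hU : has_cfc T (fun x => 1 + u * log_kernel u x) U.
  have := has_cfcD (has_cfc_poly T 1%:P) (has_cfcZ u hK).
  rewrite poly_opC scale1r; apply: has_cfc_ext => l _.
  by rewrite hornerC.
have wU l : 0 < l -> w.[l] * (1 + u * log_kernel u l) = l.
  move=> l0; rewrite (_ : w.[l] = wmean u l); last by rewrite !hornerE.
  rewrite (_ : wmean u l * _ = wmean u l + u * (l - 1)).
    by rewrite /wmean; ring.
  by rewrite /log_kernel; field; rewrite gt_eqF// wmean_gt0.
have wUT : poly_op w T * U = T.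
  rewrite -[RHS]poly_opX; apply: (has_cfc_uniq hT.1.1 _ (has_cfc_poly T 'X)).
  apply: has_cfc_ext (has_cfcM (has_cfc_poly T w) hU) => l.
  move=> /(spectrum_gt0 hT) l0.
  by rewrite wU// hornerX.
have UwT : U * poly_op w T = T.
  rewrite -[RHS]poly_opX; apply: (has_cfc_uniq hT.1.1 _ (has_cfc_poly T 'X)).
  apply: has_cfc_ext (has_cfcM hU (has_cfc_poly T w)) => l.
  move=> /(spectrum_gt0 hT) l0.
  by rewrite mulrC wU// hornerX.
set C := _ + _ in wE wE' *.
have CU : C * U = T' * (T * C * U) by rewrite !mulrA T'T mul1r.
have UC : U * C = (U * (C * T)) * T' by rewrite -!mulrA TT' mulr1.
by split; [rewrite CU -wE wUT|rewrite UC -wE' UwT].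
Qed.

(** This serves twice: it inverts T = Q B Q, with X = B, and it inverts the
    combination of inverses that defines the harmonic mean. *)
Lemma is_inverse_congr P Q X Y : is_inverse P Q -> is_inverse X Y ->
  is_inverse (Q * X * Q) (P * Y * P).
Proof.
move=> [PQ QP] [XY YX]; split.
  by rewrite -!mulrA (mulrA Q P) QP mul1r (mulrA X) XY mul1r.
by rewrite -!mulrA (mulrA P Q) PQ mul1r (mulrA Y) YX mul1r.
Qed.

(** With P, Q and T as in the introduction and T' the inverse of T, the inverses
    of A and B are Q Q and Q T' Q, so the harmonic mean is the inverse of
    Q ((1 - u) + u T') Q, namely P (1 + u k_u(T)) P = A + u P k_u(T) P, where
    k is [log_kernel]. *)
Lemma entropy_integrandE A B u : strictly_positive A -> strictly_positive B ->
  0 < u <= 1 ->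
  entropy_integrand A B u = op_pow A 2^-1 *
    cfc (op_pow A (- 2^-1) * B * op_pow A (- 2^-1)) (log_kernel u) *
    op_pow A 2^-1.
Proof.
move=> hA hB /andP[u0 u1].
set P := op_pow A 2^-1; set Q := op_pow A (- 2^-1); set T := Q * B * Q.
have PQ : P * Q = 1 by rewrite op_powD// subrr op_pow0.
have QP : Q * P = 1 by rewrite op_powD// addNr op_pow0.
have PP : P * P = A.
  by rewrite op_powD// (_ : 2^-1 + 2^-1 = 1) ?op_pow1//; field.
have iPQ : is_inverse P Q by [].
have iQP : is_inverse Q P by [].
have sQ : selfadjoint Q.
  exact: has_cfc_selfadjoint hA.1.1 (has_cfc_op_pow _ hA).
have hT : strictly_positive T.
  by apply: congr_strictly_positive => //; exists P.
have [B' iB] := hB.2.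
have pinvA : Defs.pinv A = Q * Q.
  apply: pinvE; rewrite -PP; split.
    by rewrite mulrA -(mulrA P) PQ mulr1.
  by rewrite mulrA -(mulrA Q) QP mulr1.
have iT : is_inverse T (P * B' * P) by exact: is_inverse_congr.
have pinvB : Defs.pinv B = Q * (P * B' * P) * Q.
  by rewrite (pinvE iB) -!mulrA PQ mulr1 mulrA QP mul1r.
have u01 : 0 <= u <= 1 by rewrite ltW.
have iC := harmonic_mean_inverse hT iT u01.
rewrite /entropy_integrand.
have -> : Defs.harmonic_mean u A B = P * (1 + u%:C *: cfc T (log_kernel u)) * P.
  apply: pinvE; rewrite pinvA pinvB.
  have -> : (1 - u)%:C *: (Q * Q) + u%:C *: (Q * (P * B' * P) * Q) =
      Q * ((1 - u)%:C *: (1 : 'B(H)) + u%:C *: (P * B' * P)) * Q.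
    by rewrite mulrDr mulrDl -!bop_scalerAr -!bop_scalerAl mulr1.
  exact: is_inverse_congr.
rewrite mulrDr mulrDl mulr1 PP addrAC subrr add0r.
rewrite -bop_scalerAr -bop_scalerAl scalerA -rmorphM mulVf ?gt_eqF//.
by rewrite scale1r.
Qed.

End RelativeEntropy.

Local Open Scope ring_scope.

Theorem proposition3p1 (R : realType) (H : hilbertType R) (A B : 'B(H))
    (hA : strictly_positive A) (hB : strictly_positive B) :
  riemann_integrable (entropy_integrand A B) 0 1 /\
  rel_entropy A B = usual_rel_entropy A B.
Proof.
have sQ := has_cfc_selfadjoint hA.1.1 (has_cfc_op_pow (- 2^-1) hA).
have iQ : invertible (op_pow A (- 2^-1)).
  by exists (op_pow A 2^-1); split; rewrite op_powD ?subrr ?addNr ?op_pow0.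
have hT := congr_strictly_positive sQ iQ hB.
have E : is_riemann_int (entropy_integrand A B) 0 1 (usual_rel_entropy A B).
  apply: eq_is_riemann_int (is_riemann_int_congr _ _ (log_riemann_int hT)).
    exact: ltr01.
  by move=> u u0 u1; rewrite entropy_integrandE// u0.
by split; [exists (usual_rel_entropy A B)|exact: riemann_intE E].
Qed.
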